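(* Let $\mathbb{G}$ be a Lie $2$-group, $\pi\colon\mathbb{E}\to\mathbb{X}$ a principal $\mathbb{G}$-bundle over a Lie groupoid $\mathbb{X}$, and $\mathcal{G}(\mathbb{E})$ its gauge $2$-group. Then the assignments $$(F,\omega)\mapsto\omega\circ F_*^{-1},\qquad \bigl(\Psi\colon F\Rightarrow F',\ \zeta\colon\omega\Rightarrow\omega'\bigr)\mapsto\zeta\circ_H\Psi_*^{-1}\colon\ \omega\circ F_*^{-1}\Rightarrow\omega'\circ F_*'^{-1}$$ define an action of the $2$-group $\mathcal{G}(\mathbb{E})$ on the category $\Omega^{\mathrm{semi}}_{\mathbb{E}}$ of semi-strict connection $1$-forms, and this action restricts to the category $\Omega^{\mathrm{strict}}_{\mathbb{E}}\subset\Omega^{\mathrm{semi}}_{\mathbb{E}}$ of strict connection $1$-forms.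
   Context: In a Lie groupoid, source $s$ and target $t$ are surjective submersions and $f_2\circ f_1$ is defined when $t(f_1)=s(f_2)$. A Lie $2$-group $\mathbb{G}=[G_1\rightrightarrows G_0]$ is a strict group object in Lie groupoids. A principal $\mathbb{G}$-bundle over $\mathbb{X}$ is a morphism of Lie groupoids $\pi\colon\mathbb{E}\to\mathbb{X}$ with a morphism of Lie groupoids $\mathbb{E}\times\mathbb{G}\to\mathbb{E}$ whose components are right Lie group actions, such that $\pi_i\colon E_i\to X_i$ is a principal $G_i$-bundle, $i=0,1$. The gauge $2$-group $\mathcal{G}(\mathbb{E})$ is the strict $2$-group whose objects are the automorphisms $F\colon\mathbb{E}\to\mathbb{E}$ of Lie groupoids with each $F_i$ $G_i$-equivariant and $\pi\circ F=\pi$, and whose morphisms $\Psi\colon F\Rightarrow F'$ are smooth natural isomorphisms with $\Psi(pg)=\Psi(p)1_g$ and $\pi_1(\Psi(p))=1_{\pi_0(p)}$ for $p\in E_0$, $g\in G_0$; the group product is composition of functors and horizontal composition of natural transformations, and inverses $F^{-1}$, $\Psi^{-1}\colon F^{-1}\Rightarrow F'^{-1}$ are with respect to this product. $F_*\colon T\mathbb{E}\to T\mathbb{E}$ and $\Psi_*\colon F_*\Rightarrow F'_*$ are the differentials; $\circ_H$ is horizontal composition of natural transformations. An action of a strict $2$-group $\mathcal{G}$ on a category $\mathcal{D}$ is a functor $\mathcal{G}\times\mathcal{D}\to\mathcal{D}$ which is a (left) group action on objects and on morphisms. $L(G_i)$ is the Lie algebra of $G_i$, $\mathrm{ad}$ the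 adjoint action of a group on its Lie algebra; $L(\mathbb{G})=[L(G_1)\rightrightarrows L(G_0)]$ and the tangent groupoid $T\mathbb{E}$ have structure maps the differentials of those of $\mathbb{G}$ (at $e$) and $\mathbb{E}$. $\delta\colon\mathbb{E}\times L(\mathbb{G})\to T\mathbb{E}$ is the functor $(x,B)\mapsto\delta_x(B)$, with $\delta_x$ the differential at $e$ of $g\mapsto xg$. A semi-strict connection $1$-form is a morphism of Lie groupoids $\omega=(\omega_1,\omega_0)\colon T\mathbb{E}\to L(\mathbb{G})$ with $\omega_i$ an $L(G_i)$-valued $1$-form on $E_i$, $\omega_i(v\cdot g)=\mathrm{ad}_{g^{-1}}\omega_i(v)$, for which there exists a smooth natural isomorphism $\kappa\colon\omega\circ\delta\Rightarrow\mathrm{pr}_2$, linear in $B\in L(G_0)$, with $\kappa(pg,\mathrm{ad}_{g^{-1}}B)=\mathrm{ad}_{1_g^{-1}}\kappa(p,B)$. It is strict if $\omega\circ\delta=\mathrm{pr}_2$. In $\Omega^{\mathrm{semi}}_{\mathbb{E}}$ and $\Omega^{\mathrm{strict}}_{\mathbb{E}}$ the morphisms $\omega\to\omega'$ are the smooth natural isomorphisms $\eta\colon\omega\Rightarrow\omega'$ with $\eta\colon TE_0\to L(G_1)$ an $L(G_1)$-valued $1$-form on $E_0$ and $\eta((p,v)\cdot g)=\mathrm{ad}_{1_g^{-1}}\eta(p,v)$. *)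

(* Defs.v *)
From HB Require Import structures.
From mathcomp Require Import all_boot all_order all_algebra.
From mathcomp Require Import boolp classical_sets reals topology normedtype derive.

Set Implicit Arguments.
Unset Strict Implicit.
Unset Printing Implicit Defensive.

Import Order.TTheory GRing.Theory Num.Theory numFieldNormedType.Exports.

Local Open Scope classical_set_scope.
Local Open Scope ring_scope.

(**
Conventions.

Smooth manifolds are presented by their algebras of smooth functions: a smooth
space is a set with an algebra of real functions (a Sikorski differential
space), and a manifold is a Hausdorff, second countable smooth space which is
locally diffeomorphic to open subsets of R^n (the dimension may depend on the
connected component).  Manifolds form a full subcategory of smooth spaces which
is closed under products, open and embedded submanifolds and tangent bundles,
all computed by the constructions below; so a fibre product of manifolds
along submersions is used simply as a subspace of the product.

Functions and functors are plain functions; smoothness and functoriality are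
predicates.  Categories and 2-groups are given by carriers with membership
predicates, and their operations are only meaningful on members.
*)

Section SmoothSpaces.
Variable R : realType.

Fixpoint Ck (k n : nat) (h : 'rV[R]_n -> R) : Prop :=
  if k is k'.+1 then
    (forall x, differentiable h x) /\
    (forall i : 'I_n, Ck k' (fun x => 'D_(delta_mx 0 i) h x))
  else continuous h.

Definition smooth_fun n (h : 'rV[R]_n -> R) : Prop := forall k, Ck k h.

Section Algebras.
Variable X : Type.
Implicit Types (C : set (X -> R)) (p : X).

(** The topology of (X, C) is the initial one; as C is closed under
superposition, the sets {0 < chi}, chi in C, form a basis of it. *)
Definition near_in C p (P : X -> Prop) : Prop :=
  exists2 chi, C chi & 0 < chi p /\ forall q, 0 < chi q -> P q.

Definition closed_superposition C : Prop :=
  forall n (h : 'rV[R]_n -> R) (f : 'I_n -> X -> R),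
    smooth_fun h -> (forall i, C (f i)) -> C (fun x => h (\row_i f i x)).

Definition closed_local C : Prop :=
  forall f, (forall p, exists2 g, C g & near_in C p (fun q => f q = g q)) -> C f.

(** The smallest differential structure containing [S]. *)
Definition generated (S : set (X -> R)) : set (X -> R) :=
  fun f => forall C, closed_superposition C -> closed_local C ->
    S `<=` C -> C f.

Lemma generated_superposition S : closed_superposition (generated S).
Proof.
by move=> n h f hh Cf C Cs Cl SC; apply: (Cs) => // i; exact: (Cf i C Cs Cl SC).
Qed.

Lemma generated_local S : closed_local (generated S).
Proof.
move=> f Hf C Cs Cl SC; apply: (Cl) => p.
have [g Cg [chi Cchi H]] := Hf p.
by exists g; [exact: (Cg C Cs Cl SC) | exists chi; [exact: (Cchi C Cs Cl SC)|]].
Qed.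

End Algebras.

Record smoothSpace := SmoothSpace {
  carrier :> Type;
  smooth_real : set (carrier -> R);
  smooth_realD : closed_superposition smooth_real;
  smooth_realL : closed_local smooth_real }.

Definition genSpace (X : Type) (S : set (X -> R)) : smoothSpace :=
  SmoothSpace (@generated_superposition X S) (@generated_local X S).

(** The smooth real functions on R^n are those satisfying [smooth_fun]: these
are stable under superposition and local, and each is a superposition of the
coordinates. *)
Definition euclid (n : nat) : smoothSpace :=
  @genSpace 'rV[R]_n [set f | exists i, f = (fun x : 'rV[R]_n => x 0 i)].

Definition prodS (M N : smoothSpace) : smoothSpace :=
  @genSpace (M * N)%type
    [set f | (exists2 g, smooth_real g & f = (fun x : M * N => g x.1)) \/
             (exists2 g, smooth_real g & f = (fun x : M * N => g x.2))].

Definition subS (M : smoothSpace) (A : set M) : smoothSpace :=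
  @genSpace {x : M | A x}
    [set f | exists2 g, smooth_real g & f = (fun x : {x : M | A x} => g (sval x))].

Definition smooth (M N : smoothSpace) (f : M -> N) : Prop :=
  forall g : N -> R, smooth_real g -> smooth_real (fun x => g (f x)).

Definition diffeo (M N : smoothSpace) (f : M -> N) : Prop :=
  smooth f /\ exists g : N -> M, [/\ smooth g, cancel f g & cancel g f].

Definition openS (M : smoothSpace) (U : set M) : Prop :=
  forall p, U p -> near_in (@smooth_real M) p U.

Definition is_manifold (M : smoothSpace) : Prop :=
  [/\ forall p q : M, p <> q -> exists U V : set M,
        [/\ openS U, openS V, U p, V q & U `&` V = set0],
      exists B : nat -> set M, (forall i, openS (B i)) /\
        forall (U : set M) p, openS U -> U p ->
          exists i, B i p /\ B i `<=` U
    & forall p : M, exists (n : nat) (U : set M) (V : set (euclid n)),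
        [/\ openS U, @open 'rV[R]_n V, U p
          & exists f : subS U -> subS V, diffeo f] ].

(** Tangent vectors at [p] are the derivations at [p] of germs of smooth
functions, the Leibniz rule being stated for arbitrary smooth operations:
h(x, y) = x + y, c x and x y give linearity and the usual Leibniz rule, and
conversely the general rule follows from these by Hadamard's lemma. *)
Record Cinf (M : smoothSpace) := MkCinf {
  cfun :> M -> R;
  cfunP : smooth_real cfun }.

Definition is_derivation (M : smoothSpace) (p : M) (v : Cinf M -> R) : Prop :=
  (forall f g : Cinf M,
     near_in (@smooth_real M) p (fun q => f q = g q) -> v f = v g) /\
  (forall n (h : 'rV[R]_n -> R) (f : 'I_n -> Cinf M) (g : Cinf M),
     smooth_fun h -> (forall x, g x = h (\row_i f i x)) ->
     v g = \sum_i 'D_(delta_mx 0 i) h (\row_i f i p) * v (f i)).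

Record Tan (M : smoothSpace) (p : M) := MkTan {
  der :> Cinf M -> R;
  derP : is_derivation p der }.

Section TanModule.
Variables (M : smoothSpace) (p : M).
Implicit Types v w : Tan p.

Lemma Tan_ext v w : (forall f, v f = w f) -> v = w.
Proof.
case: v w => [v Pv] [w Pw] /= vw; have {}vw : v = w by apply: funext.
by case: _ / vw Pw => Pw; rewrite (Prop_irrelevance Pv Pw).
Qed.

Lemma tan0_subproof : is_derivation p (fun=> 0).
Proof. by split=> // n h f g _ _; rewrite big1 // => i _; rewrite mulr0. Qed.

Lemma tanD_subproof v w : is_derivation p (fun f => v f + w f).
Proof.
case: v w => [v [vl vc]] [w [wl wc]] /=; split=> [f g fg|n h f g sh gh].
  by rewrite (vl _ _ fg) (wl _ _ fg).
rewrite (vc _ _ _ _ sh gh) (wc _ _ _ _ sh gh) -big_split /=.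
by apply: eq_bigr => i _; rewrite mulrDr.
Qed.

Lemma tanZ_subproof (a : R) v : is_derivation p (fun f => a * v f).
Proof.
case: v => [v [vl vc]] /=; split=> [f g fg|n h f g sh gh].
  by rewrite (vl _ _ fg).
rewrite (vc _ _ _ _ sh gh) mulr_sumr.
by apply: eq_bigr => i _; rewrite mulrCA.
Qed.

Definition tan0 := MkTan tan0_subproof.
Definition tanD v w := MkTan (tanD_subproof v w).
Definition tanZ a v := MkTan (tanZ_subproof a v).
Definition tanN v := tanZ (-1) v.

HB.instance Definition _ := gen_eqMixin (Tan p).
HB.instance Definition _ := gen_choiceMixin (Tan p).

Fact tanDA : associative tanD.
Proof. by move=> u v w; apply: Tan_ext => f /=; rewrite addrA. Qed.
Fact tanDC : commutative tanD.
Proof. by move=> u v; apply: Tan_ext => f /=; rewrite addrC. Qed.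
Fact tan0D : left_id tan0 tanD.
Proof. by move=> u; apply: Tan_ext => f /=; rewrite add0r. Qed.
Fact tanND : left_inverse tan0 tanN tanD.
Proof. by move=> u; apply: Tan_ext => f /=; rewrite mulN1r addNr. Qed.

HB.instance Definition _ :=
  GRing.isZmodule.Build (Tan p) tanDA tanDC tan0D tanND.

Fact tanZA a b v : tanZ a (tanZ b v) = tanZ (a * b) v.
Proof. by apply: Tan_ext => f /=; rewrite mulrA. Qed.
Fact tan1Z : left_id 1 tanZ.
Proof. by move=> v; apply: Tan_ext => f /=; rewrite mul1r. Qed.
Fact tanZDr : right_distributive tanZ +%R.
Proof. by move=> a v w; apply: Tan_ext => f /=; rewrite mulrDr. Qed.
Fact tanZDl v : {morph tanZ^~ v : a b / a + b}.
Proof. by move=> a b; apply: Tan_ext => f /=; rewrite mulrDl. Qed.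

HB.instance Definition _ :=
  GRing.Zmodule_isLmodule.Build R (Tan p) tanZA tan1Z tanZDr tanZDl.

End TanModule.

Definition TanS (M : smoothSpace) (p : M) : smoothSpace :=
  @genSpace (Tan p) [set F | exists f : Cinf M, F = (fun v : Tan p => v f)].

(** The usual smooth structure of the tangent bundle: locally generated by the
functions x_i and dx_i of a chart. *)
Definition TM (M : smoothSpace) : smoothSpace :=
  @genSpace {p : M & Tan p}
    [set F | (exists f : Cinf M, F = (fun v : {p : M & Tan p} => f (projT1 v))) \/
             (exists f : Cinf M, F = (fun v : {p : M & Tan p} => projT2 v f))].

Definition tvec (M : smoothSpace) (p : M) (v : Tan p) : TM M :=
  existT (fun p : M => Tan p) p v.

Definition pullC (M N : smoothSpace) (f : M -> N) (sf : smooth f) (g : Cinf N) :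
  Cinf M := MkCinf (sf g (cfunP g)).

Lemma push_subproof (M N : smoothSpace) (f : M -> N) (p : M) (q : N)
    (sf : smooth f) (fp : f p = q) (v : Tan p) :
  is_derivation q (fun g => v (pullC sf g)).
Proof.
case: v => [v [vl vc]] /=; split=> [g1 g2 [chi Cchi [chi0 H]]|n h g1 g2 sh gh].
  apply: vl; exists (fun x => chi (f x)); first exact: sf.
  by split=> [|x /H //]; rewrite fp.
rewrite (vc _ _ (fun i => pullC sf (g1 i)) _ sh) => [|x]; last exact: gh.
by rewrite -fp.
Qed.

(** The differential at [p] of a smooth [f] with [f p = q]; zero otherwise. *)
Definition dif_at (M N : smoothSpace) (f : M -> N) (p : M) (q : N)
    (v : Tan p) : Tan q :=
  match pselect (smooth f /\ f p = q) with
  | left H => MkTan (push_subproof (proj1 H) (proj2 H) v)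
  | right _ => 0
  end.

Definition dif (M N : smoothSpace) (f : M -> N) (v : TM M) : TM N :=
  tvec (dif_at f (f (projT1 v)) (projT2 v)).

Definition fibre_linear (M N : smoothSpace) (q : N) (w : TM M -> TanS q) : Prop :=
  forall (p : M) (a : R) (u v : Tan p),
    w (tvec (a *: u + v)) = a *: (w (tvec u) : Tan q) + w (tvec v).

(** Forms on [M] with values in the vector space [T_q N]. *)
Definition is_oneform (M N : smoothSpace) (q : N) (w : TM M -> TanS q) : Prop :=
  smooth w /\ fibre_linear w.

Definition submersion (M N : smoothSpace) (f : M -> N) : Prop :=
  smooth f /\
  forall (p : M) (w : Tan (f p)), exists v : Tan p, dif_at f (f p) v = w.

End SmoothSpaces.

Arguments tvec {R M p} v.
Arguments dif_at {R M N} f p q v.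

Section Groups.

Record groupOps (T : Type) := GroupOps {
  gmul : T -> T -> T;
  gone : T;
  ginv : T -> T }.

Definition is_group (T : Type) (A : set T) (o : groupOps T) : Prop :=
  [/\ A (gone o),
      forall x y, A x -> A y -> A (gmul o x y),
      forall x y z, A x -> A y -> A z ->
        gmul o x (gmul o y z) = gmul o (gmul o x y) z,
      forall x, A x -> gmul o (gone o) x = x /\ gmul o x (gone o) = x
    & forall x, A x -> [/\ A (ginv o x), gmul o (ginv o x) x = gone o
                         & gmul o x (ginv o x) = gone o] ].

(** The group operations determined by a product and a unit on [A]. *)
Definition group_of (T : Type) (A : set T) (mul : T -> T -> T) (one : T) :
    groupOps T :=
  GroupOps mul one (fun x =>
    match pselect (exists y, [/\ A y, mul x y = one & mul y x = one]) with
    | left H => projT1 (cid H)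
    | right _ => x
    end).

(** Raw categories: [cob] and [car] carve out the objects and the arrows. *)
Record rawCat := RawCat {
  Ob : Type;
  Ar : Type;
  cob : set Ob;
  car : set Ar;
  csrc : Ar -> Ob;
  ctgt : Ar -> Ob;
  cid1 : Ob -> Ar;
  ccmp : Ar -> Ar -> Ar }.

Definition is_category (C : rawCat) : Prop :=
  [/\ forall f : Ar C, car f -> cob (csrc f) /\ cob (ctgt f),
      forall x : Ob C, cob x ->
        [/\ car (cid1 x), csrc (cid1 x) = x & ctgt (cid1 x) = x],
      forall f g : Ar C, car f -> car g -> csrc g = ctgt f ->
        [/\ car (ccmp g f), csrc (ccmp g f) = csrc f
          & ctgt (ccmp g f) = ctgt g],
      forall f : Ar C, car f ->
        ccmp f (cid1 (csrc f)) = f /\ ccmp (cid1 (ctgt f)) f = f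
    & forall f g h : Ar C, car f -> car g -> car h ->
        csrc g = ctgt f -> csrc h = ctgt g ->
        ccmp h (ccmp g f) = ccmp (ccmp h g) f ].

Definition full_sub (C : rawCat) (P : set (Ob C)) : rawCat :=
  @RawCat (Ob C) (Ar C) (@cob C `&` P)
    [set f | [/\ car f, P (csrc f) & P (ctgt f)]]
    (@csrc C) (@ctgt C) (@cid1 C) (@ccmp C).

Record raw2group := Raw2group {
  cat2 :> rawCat;
  grp0 : groupOps (Ob cat2);
  grp1 : groupOps (Ar cat2) }.

(** Group objects in categories. *)
Definition is_strict_2group (K : raw2group) : Prop :=
  [/\ is_category K,
      is_group (@cob K) (grp0 K),
      is_group (@car K) (grp1 K),
      forall f g : Ar K, car f -> car g ->
        csrc (gmul (grp1 K) f g) = gmul (grp0 K) (csrc f) (csrc g) /\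
        ctgt (gmul (grp1 K) f g) = gmul (grp0 K) (ctgt f) (ctgt g)
    & (forall x y : Ob K, cob x -> cob y ->
         cid1 (gmul (grp0 K) x y) = gmul (grp1 K) (cid1 x) (cid1 y)) /\
      (forall f g f' g' : Ar K, car f -> car g -> car f' -> car g' ->
         csrc g = ctgt f -> csrc g' = ctgt f' ->
         gmul (grp1 K) (ccmp g f) (ccmp g' f') =
         ccmp (gmul (grp1 K) g g') (gmul (grp1 K) f f')) ].

(** A functor [K * D -> D] which is a left group action on objects and on
arrows. *)
Definition is_action (K : raw2group) (D : rawCat)
    (a0 : Ob K -> Ob D -> Ob D) (a1 : Ar K -> Ar D -> Ar D) : Prop :=
  [/\ (forall x y, cob x -> cob y -> cob (a0 x y)) /\
      (forall f g, car f -> car g ->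
         [/\ car (a1 f g), csrc (a1 f g) = a0 (csrc f) (csrc g)
           & ctgt (a1 f g) = a0 (ctgt f) (ctgt g)]),
      forall x y, cob x -> cob y -> a1 (cid1 x) (cid1 y) = cid1 (a0 x y),
      forall f f' g g', car f -> car f' -> car g -> car g' ->
        csrc f' = ctgt f -> csrc g' = ctgt g ->
        a1 (ccmp f' f) (ccmp g' g) = ccmp (a1 f' g') (a1 f g),
      (forall y, cob y -> a0 (gone (grp0 K)) y = y) /\
      (forall x x' y, cob x -> cob x' -> cob y ->
         a0 (gmul (grp0 K) x x') y = a0 x (a0 x' y))
    & (forall g, car g -> a1 (gone (grp1 K)) g = g) /\
      (forall f f' g, car f -> car f' -> car g ->
         a1 (gmul (grp1 K) f f') g = a1 f (a1 f' g)) ].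

End Groups.

Section Groupoids.
Variable R : realType.
Local Notation smoothSpace := (smoothSpace R).

(** The structure maps of a groupoid in smooth spaces; [gP] is the space of
composable pairs, [pr1] the arrow applied first. *)
Record gpd := Gpd {
  g0 : smoothSpace;
  g1 : smoothSpace;
  gP : smoothSpace;
  src : g1 -> g0;
  tgt : g1 -> g0;
  uni : g0 -> g1;
  inv : g1 -> g1;
  pr1 : gP -> g1;
  pr2 : gP -> g1;
  cmp : gP -> g1 }.

(** [h] is the composite [g o f]. *)
Definition is_comp (D : gpd) (g f h : g1 D) : Prop :=
  exists w : gP D, [/\ pr1 w = f, pr2 w = g & cmp w = h].

Definition gcomp (D : gpd) (g f : g1 D) : g1 D :=
  match pselect (exists h, is_comp g f h) with
  | left H => projT1 (cid H)
  | right _ => f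
  end.

Definition prodG (D D' : gpd) : gpd :=
  @Gpd (prodS (g0 D) (g0 D')) (prodS (g1 D) (g1 D')) (prodS (gP D) (gP D'))
    (fun f => (src f.1, src f.2)) (fun f => (tgt f.1, tgt f.2))
    (fun x => (uni x.1, uni x.2)) (fun f => (inv f.1, inv f.2))
    (fun w => (pr1 w.1, pr1 w.2)) (fun w => (pr2 w.1, pr2 w.2))
    (fun w => (cmp w.1, cmp w.2)).

(** The composable pairs of the tangent groupoid are the tangent vectors of the
manifold of composable pairs, T(D1 x_D0 D1) = T D1 x_(T D0) T D1. *)
Definition TG (D : gpd) : gpd :=
  @Gpd (TM (g0 D)) (TM (g1 D)) (TM (gP D))
    (dif (@src D)) (dif (@tgt D)) (dif (@uni D)) (dif (@inv D))
    (dif (@pr1 D)) (dif (@pr2 D)) (dif (@cmp D)).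

(** Functors and transformations are pairs (arrow part, object part) and maps
from objects to arrows. *)
Definition fpair (D D' : gpd) : Type := ((g1 D -> g1 D') * (g0 D -> g0 D'))%type.

Definition is_mor (D D' : gpd) (F : fpair D D') : Prop :=
  [/\ smooth F.1 /\ smooth F.2,
      forall f, src (F.1 f) = F.2 (src f) /\ tgt (F.1 f) = F.2 (tgt f),
      forall x, F.1 (uni x) = uni (F.2 x)
    & forall w : gP D, is_comp (F.1 (pr2 w)) (F.1 (pr1 w)) (F.1 (cmp w)) ].

Definition fid (D : gpd) : fpair D D := (id, id).

Definition fcomp (D D' D'' : gpd) (G : fpair D' D'') (F : fpair D D') :
  fpair D D'' := (G.1 \o F.1, G.2 \o F.2).

Definition Tfun (D D' : gpd) (F : fpair D D') : fpair (TG D) (TG D') :=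
  (dif F.1, dif F.2).

(** Smooth natural transformations; they are isomorphisms when [D'] is a
groupoid. *)
Definition is_nat (D D' : gpd) (F F' : fpair D D') (eta : g0 D -> g1 D') : Prop :=
  [/\ smooth eta,
      forall x, src (eta x) = F.2 x /\ tgt (eta x) = F'.2 x
    & forall f : g1 D, exists h,
        is_comp (eta (tgt f)) (F.1 f) h /\ is_comp (F'.1 f) (eta (src f)) h ].

Record nt (D D' : gpd) := Nt {
  ndom : fpair D D';
  ncod : fpair D D';
  ncmp :> g0 D -> g1 D' }.

Definition nid (D D' : gpd) (F : fpair D D') : nt D D' :=
  Nt F F (fun x => uni (F.2 x)).

Definition vcomp (D D' : gpd) (eta' eta : nt D D') : nt D D' :=
  Nt (ndom eta) (ncod eta') (fun x => gcomp (eta' x) (eta x)).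

Definition hcomp (D D' D'' : gpd) (zeta : nt D' D'') (eta : nt D D') : nt D D'' :=
  Nt (fcomp (ndom zeta) (ndom eta)) (fcomp (ncod zeta) (ncod eta))
     (fun x => gcomp (zeta ((ncod eta).2 x)) ((ndom zeta).1 (eta x))).

Definition Tnt (D D' : gpd) (eta : nt D D') : nt (TG D) (TG D') :=
  Nt (Tfun (ndom eta)) (Tfun (ncod eta)) (dif eta).

Definition pairs (M0 M1 : smoothSpace) (s t : M1 -> M0) : smoothSpace :=
  subS (M := prodS M1 M1) (fun w : M1 * M1 => t w.1 = s w.2).

Definition pair_gpd (M0 M1 : smoothSpace) (s t : M1 -> M0) (u : M0 -> M1)
    (i : M1 -> M1) (m : pairs s t -> M1) : gpd :=
  @Gpd M0 M1 (pairs s t) s t u i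
    (fun w => (sval w).1) (fun w => (sval w).2) m.

Record lieGroupoid := LieGroupoid {
  lg0 : smoothSpace;
  lg1 : smoothSpace;
  lgs : lg1 -> lg0;
  lgt : lg1 -> lg0;
  lgu : lg0 -> lg1;
  lgi : lg1 -> lg1;
  lgm : pairs lgs lgt -> lg1;
  lg_gpd :> gpd := pair_gpd lgu lgi lgm;
  lg0_mfd : is_manifold lg0;
  lg1_mfd : is_manifold lg1;
  lgs_sub : submersion lgs /\ (forall x, exists f, lgs f = x);
  lgt_sub : submersion lgt /\ (forall x, exists f, lgt f = x);
  lgu_sm : smooth lgu;
  lgi_sm : smooth lgi;
  lgm_sm : smooth lgm;
  lgm_st : forall w : gP lg_gpd,
    src (cmp w) = src (pr1 w) /\ tgt (cmp w) = tgt (pr2 w);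
  lgu_st : forall x : g0 lg_gpd, src (uni x) = x /\ tgt (uni x) = x;
  lgi_st : forall f : g1 lg_gpd, src (inv f) = tgt f /\ tgt (inv f) = src f;
  lg_unit : forall f : g1 lg_gpd,
    is_comp f (uni (src f)) f /\ is_comp (uni (tgt f)) f f;
  lg_inv : forall f : g1 lg_gpd,
    is_comp (inv f) f (uni (src f)) /\ is_comp f (inv f) (uni (tgt f));
  lg_assoc : forall f g h fg gh k : g1 lg_gpd,
    is_comp g f fg -> is_comp h g gh -> is_comp h fg k -> is_comp gh f k }.

Definition is_lie_group (M : smoothSpace) (o : groupOps M) : Prop :=
  [/\ is_manifold M, is_group setT o,
      smooth (fun x : prodS M M => gmul o x.1 x.2) & smooth (ginv o) ].

(** The three last fields say that product, inverse and unit are functors. *)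
Record lie2group := Lie2group {
  l2_gpd :> lieGroupoid;
  op0 : groupOps (g0 l2_gpd);
  op1 : groupOps (g1 l2_gpd);
  op0P : is_lie_group op0;
  op1P : is_lie_group op1;
  l2_mul : @is_mor (prodG l2_gpd l2_gpd) l2_gpd
    (fun x => gmul op1 x.1 x.2, fun x => gmul op0 x.1 x.2);
  l2_inv : @is_mor l2_gpd l2_gpd (ginv op1, ginv op0);
  l2_one : [/\ src (gone op1) = gone op0, tgt (gone op1) = gone op0
             & uni (gone op0) = gone op1] }.

Lemma one_pair (G : lie2group) :
  tgt (g := G) (gone (op1 G), gone (op1 G)).1 =
  src (g := G) (gone (op1 G), gone (op1 G)).2.
Proof. by have [-> -> _] := l2_one G. Qed.

Definition oneP (G : lie2group) : gP G :=
  exist _ (gone (op1 G), gone (op1 G)) (one_pair G).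

Definition LG (G : lie2group) : gpd :=
  let e0 := gone (op0 G) in
  let e1 := gone (op1 G) in
  let e := oneP G in
  @Gpd (TanS e0) (TanS e1) (TanS e)
    (dif_at (@src G) e1 e0) (dif_at (@tgt G) e1 e0)
    (dif_at (@uni G) e0 e1) (dif_at (@inv G) e1 e1)
    (dif_at (@pr1 G) e e1) (dif_at (@pr2 G) e e1) (dif_at (@cmp G) e e1).

Definition Ad (M : smoothSpace) (o : groupOps M) (g : M) :
    TanS (gone o) -> TanS (gone o) :=
  dif_at (fun h => gmul o (gmul o g h) (ginv o g)) (gone o) (gone o).

Definition is_right_action (P M : smoothSpace) (o : groupOps M)
    (act : P -> M -> P) : Prop :=
  [/\ smooth (fun x : prodS P M => act x.1 x.2),
      forall p, act p (gone o) = p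
    & forall p g h, act p (gmul o g h) = act (act p g) h ].

Definition is_principal (P X M : smoothSpace) (o : groupOps M)
    (pi : P -> X) (act : P -> M -> P) : Prop :=
  [/\ smooth pi, forall p g, pi (act p g) = pi p
    & forall x : X, exists U : set X, [/\ openS U, U x &
        exists phi : subS (fun p : P => U (pi p)) -> prodS (subS U) M,
        [/\ diffeo phi, forall p, sval (phi p).1 = pi (sval p)
          & forall p q g, sval q = act (sval p) g ->
              phi q = ((phi p).1, gmul o (phi p).2 g)]] ].

Record principal2bundle (G : lie2group) (X : lieGroupoid) := Principal2bundle {
  tot :> lieGroupoid;
  bproj1 : g1 tot -> g1 X;
  bproj0 : g0 tot -> g0 X;
  act1 : g1 tot -> g1 G -> g1 tot;
  act0 : g0 tot -> g0 G -> g0 tot;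
  proj_mor : @is_mor tot X (bproj1, bproj0);
  act_mor : @is_mor (prodG tot G) tot
    (fun x => act1 x.1 x.2, fun x => act0 x.1 x.2);
  act1P : is_right_action (op1 G) act1;
  act0P : is_right_action (op0 G) act0;
  pb1 : is_principal (op1 G) bproj1 act1;
  pb0 : is_principal (op0 G) bproj0 act0 }.

End Groupoids.

Arguments bproj1 {R G X} E f : rename.
Arguments bproj0 {R G X} E p : rename.
Arguments act1 {R G X} E p g : rename.
Arguments act0 {R G X} E p g : rename.

Section Gauge.
Variables (R : realType) (G : lie2group R) (X : lieGroupoid R).
Variable E : principal2bundle G X.

Local Notation one_ g := (uni (g := G) g).
Local Notation inv0 g := (ginv (op0 G) g).
Local Notation inv1 g := (ginv (op1 G) g).

Definition gauge_ob (F : fpair E E) : Prop :=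
  [/\ is_mor F,
      exists F' : fpair E E, [/\ is_mor F', fcomp F F' = fid E & fcomp F' F = fid E],
      (forall p g, F.1 (act1 E p g) = act1 E (F.1 p) g) /\
      (forall p g, F.2 (act0 E p g) = act0 E (F.2 p) g)
    & (forall p, bproj1 E (F.1 p) = bproj1 E p) /\
      (forall p, bproj0 E (F.2 p) = bproj0 E p) ].

Definition gauge_ar (Psi : nt E E) : Prop :=
  [/\ gauge_ob (ndom Psi) /\ gauge_ob (ncod Psi),
      is_nat (ndom Psi) (ncod Psi) Psi,
      forall p g, Psi (act0 E p g) = act1 E (Psi p) (one_ g)
    & forall p, bproj1 E (Psi p) = uni (g := X) (bproj0 E p) ].

Definition gauge_cat : rawCat :=
  RawCat gauge_ob gauge_ar (@ndom R E E) (@ncod R E E) (@nid R E E) (@vcomp R E E).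

Definition gauge_2group : raw2group :=
  @Raw2group gauge_cat
    (group_of gauge_ob (@fcomp R E E E) (fid E))
    (group_of gauge_ar (@hcomp R E E E) (nid (fid E))).

Definition delta : fpair (prodG E (LG G)) (TG E) :=
  (fun x => tvec (dif_at (fun g => act1 E x.1 g) (gone (op1 G)) x.1 x.2),
   fun x => tvec (dif_at (fun g => act0 E x.1 g) (gone (op0 G)) x.1 x.2)).

Definition proj_LG : fpair (prodG E (LG G)) (LG G) :=
  (fun x => x.2, fun x => x.2).

Definition tact1 (v : TM (g1 E)) (g : g1 G) : TM (g1 E) :=
  dif (fun p => act1 E p g) v.

Definition tact0 (v : TM (g0 E)) (g : g0 G) : TM (g0 E) :=
  dif (fun p => act0 E p g) v.

Definition semi_strict (w : fpair (TG E) (LG G)) : Prop :=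
  [/\ is_mor w,
      is_oneform w.1 /\ is_oneform w.2,
      (forall v g, w.1 (tact1 v g) = Ad (inv1 g) (w.1 v)) /\
      (forall v g, w.2 (tact0 v g) = Ad (inv0 g) (w.2 v))
    & exists kappa : prodS (g0 E) (g0 (LG G)) -> g1 (LG G),
      [/\ is_nat (fcomp w delta) proj_LG kappa,
          forall p (a : R) (B C : Tan (gone (op0 G))),
            kappa (p, a *: B + C) =
            a *: (kappa (p, B) : Tan (gone (op1 G))) + kappa (p, C)
        & forall p (B : Tan (gone (op0 G))) g,
            kappa (act0 E p g, Ad (inv0 g) B) =
            Ad (inv1 (one_ g)) (kappa (p, B))] ].

Definition strict (w : fpair (TG E) (LG G)) : Prop := fcomp w delta = proj_LG.

Definition omega_ar (eta : nt (TG E) (LG G)) : Prop :=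
  [/\ semi_strict (ndom eta) /\ semi_strict (ncod eta),
      is_nat (ndom eta) (ncod eta) eta,
      is_oneform eta
    & forall v g, eta (tact0 v g) = Ad (inv1 (one_ g)) (eta v) ].

Definition Omega_semi : rawCat :=
  RawCat semi_strict omega_ar (@ndom R (TG E) (LG G)) (@ncod R (TG E) (LG G))
    (@nid R (TG E) (LG G)) (@vcomp R (TG E) (LG G)).

Definition Omega_strict : rawCat := @full_sub Omega_semi strict.

Definition gauge_act0 (F : Ob gauge_2group) (w : Ob Omega_semi) : Ob Omega_semi :=
  fcomp w (Tfun (ginv (grp0 gauge_2group) F)).

Definition gauge_act1 (Psi : Ar gauge_2group) (zeta : Ar Omega_semi) :
    Ar Omega_semi :=
  hcomp zeta (Tnt (ginv (grp1 gauge_2group) Psi)).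

End Gauge.

(* Main.v *)
(**
Everything takes place in transformations with values in the groupoids E and
L(G), for which vertical and horizontal composition obey the usual laws.  The
only compositions needed in the tangent groupoid TE are the differentials of
smooth families of compositions in E, which a connection form sends to
compositions in L(G); composability in TE itself is never analysed.

In G the composite of y and x with s(y) = t(x) is y 1_{s(y)}^-1 x.
Differentiating at the unit with the product rule, composition in L(G) is
(b, a) |-> b + a - 1_{s(b)}; hence composites of smooth maps (resp. of 1-forms,
of equivariant maps) into L(G_1) are again smooth (resp. 1-forms, equivariant).

The inverse of Psi : F => F' for horizontal composition is
x |-> F^-1(Psi(F'^-1 x)^-1).  By uniqueness of inverses, inversion commutes with
vertical composition and with taking sources and targets, and the action axioms
become the interchange law and the associativity of horizontal composition.
A gauge transformation preserves the fundamental vector fields, so kappa is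
transported along F^-1 and strictness is preserved.
*)

From HB Require Import structures.
From mathcomp Require Import all_boot all_order all_algebra.
From mathcomp Require Import boolp classical_sets reals topology normedtype derive.
Require Import Defs.

Set Implicit Arguments.
Unset Strict Implicit.
Unset Printing Implicit Defensive.

Import GRing.Theory numFieldNormedType.Exports.
Local Open Scope classical_set_scope.
Local Open Scope ring_scope.

(** * Smooth maps and differentials *)

Section SmoothMaps.
Variable R : realType.
Implicit Types M N P : smoothSpace R.

Lemma smooth_fun_cst n (c : R) : smooth_fun (fun _ : 'rV[R]_n => c).
Proof.
move=> k; elim: k c => [|k IHk] c /=; first by move=> x; exact: cst_continuous.
split=> [x|i]; first exact: differentiable_cst.
rewrite [X in Ck k X](_ : _ = fun=> 0); first exact: IHk.
by apply: funext => x; rewrite derive_cst.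
Qed.

(** A directional derivative of a linear map is constant, so one differentiation reduces to
    [smooth_fun_cst]. *)
Lemma smooth_fun_linear n (f : {linear 'rV[R]_n -> R}) :
  continuous f -> smooth_fun f.
Proof.
move=> cf [//|k] /=; split=> [x|i]; first exact: linear_differentiable.
rewrite [X in Ck k X](_ : _ = fun=> f (delta_mx 0 i)); first exact: smooth_fun_cst.
apply: funext => x; rewrite deriveE; last exact: linear_differentiable.
by rewrite diff_lin.
Qed.

Lemma smooth_fun_addZ (a : R) :
  smooth_fun (fun x : 'rV[R]_2 => x 0 0 + a * x 0 1).
Proof.
pose h (x : 'rV[R]_2) : R := x 0 0 + a * x 0 1.
have lh : linear h.
  by move=> b x y; rewrite /h !mxE mulrDr addrACA scalerDr [a * _]mulrCA.
pose HL := GRing.isLinear.Build R 'rV[R]_2 R _ h lh.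
pose hL : {linear 'rV[R]_2 -> R} := HB.pack h HL.
apply: (@smooth_fun_linear 2 hL) => x.
apply: (@continuousD _ _ _ (fun x : 'rV[R]_2 => x 0 0)
  (fun x : 'rV[R]_2 => a * x 0 1)); first exact: coord_continuous.
apply: (@continuousZl_tmp _ _ _ (fun x : 'rV[R]_2 => x 0 1)).
exact: coord_continuous.
Qed.

Lemma smooth_real_cst M (c : R) : smooth_real (fun _ : M => c).
Proof.
by apply: (@smooth_realD _ M 0 (fun=> c) (fun _ _ => c) (smooth_fun_cst 0 c)); case.
Qed.

Lemma smooth_real_addZ M (a : R) (f g : M -> R) :
  smooth_real f -> smooth_real g -> smooth_real (fun x => f x + a * g x).
Proof.
move=> sf sg; pose F (i : 'I_2) := if i == 0 then f else g.
have := @smooth_realD _ M 2 _ F (smooth_fun_addZ a) _.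
rewrite (_ : (fun x => _) = fun x => f x + a * g x); last first.
  by apply: funext => x; rewrite !mxE.
by apply=> i; rewrite /F; case: ifP.
Qed.

Lemma generated_sub (X : Type) (S : set (X -> R)) : S `<=` generated S.
Proof. by move=> f Sf C _ _; apply. Qed.

(** The functions with smooth pullback along [f] are stable under superposition and localisation, so
    they contain everything that [S] generates. *)
Lemma smooth_gen M (X : Type) (S : set (X -> R)) (f : M -> genSpace S) :
  (forall g, S g -> smooth_real (fun x => g (f x))) -> smooth f.
Proof.
move=> Sf g Sg; pose C := [set g : X -> R | smooth_real (fun x => g (f x))].
apply: (Sg C) => [n h F sh CF|F HF|h /Sf//].
  exact: (smooth_realD sh).
apply: smooth_realL => p; have [G CG [chi Cchi [chi0 H]]] := HF (f p).
exists (fun x => G (f x)) => //; exists (fun x => chi (f x)) => //.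
by split=> // q; apply: H.
Qed.

Lemma smooth_id M : smooth (fun x : M => x). Proof. by []. Qed.

Lemma smooth_comp M N P (g : N -> P) (f : M -> N) :
  smooth g -> smooth f -> smooth (fun x => g (f x)).
Proof. by move=> sg sf h /sg/sf. Qed.

Lemma smooth_cst M N (q : N) : smooth (fun _ : M => q).
Proof. by move=> g _; exact: smooth_real_cst. Qed.

Lemma smooth_pair M N P (f : M -> N) (g : M -> P) :
  smooth f -> smooth g -> smooth (N := prodS N P) (fun x => (f x, g x)).
Proof. by move=> sf sg; apply: smooth_gen => h [|] [k sk ->] /=; [apply: sf|apply: sg]. Qed.

Lemma smooth_fst M N : smooth (M := prodS M N) (fun x => x.1).
Proof. by move=> g sg; apply: generated_sub; left; exists g. Qed.

Lemma smooth_snd M N : smooth (M := prodS M N) (fun x => x.2).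
Proof. by move=> g sg; apply: generated_sub; right; exists g. Qed.

Lemma smooth_sval M (A : set M) : smooth (M := subS A) (fun x => sval x).
Proof. by move=> g sg; apply: generated_sub; exists g. Qed.

Lemma smooth_sub M N (A : set N) (f : M -> subS A) :
  smooth (fun x => sval (f x)) -> smooth f.
Proof. by move=> sf; apply: smooth_gen => h [k sk ->]; apply: sf. Qed.

(** * Tangent vectors as derivations, and differentials *)

Lemma Cinf_ext M (f g : Cinf M) : cfun f = cfun g -> f = g.
Proof.
by case: f g => [f sf] [g sg] /= fg; case: _ / fg sg => sg; rewrite (Prop_irrelevance sf sg).
Qed.

(** A constant is a superposition of no functions at all, and the chain rule then gives an empty
    sum. *)
Lemma Tan_cst M (p : M) (v : Tan p) (f : Cinf M) (c : R) :
  (forall x, f x = c) -> v f = 0.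
Proof.
move=> fc; case: v => v [vl vc] /=.
by rewrite (vc _ _ (fun=> f) f (smooth_fun_cst 0 c) fc) big_ord0.
Qed.

Lemma dif_atE M N (f : M -> N) p q (sf : smooth f) (fp : f p = q) (v : Tan p)
  (h : Cinf N) : dif_at f p q v h = v (pullC sf h).
Proof.
rewrite /dif_at; case: pselect => [[sf' fp']|]; last by case.
by rewrite /=; congr (der v _); apply: Cinf_ext.
Qed.

Lemma eq_dif_at M N (f g : M -> N) p q (v : Tan p) :
  (forall x, f x = g x) -> dif_at f p q v = dif_at g p q v.
Proof. by move=> fg; congr (dif_at _ p q v); apply: funext. Qed.

Lemma dif_at_linear M N (f : M -> N) p q : linear (dif_at f p q).
Proof.
move=> a u v; rewrite /dif_at; case: pselect => [H|_]; last by rewrite scaler0 addr0.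
exact: Tan_ext.
Qed.

HB.instance Definition _ M N (f : M -> N) p q :=
  GRing.isLinear.Build R (Tan p) (Tan q) _ (dif_at f p q) (@dif_at_linear M N f p q).

Lemma dif_atD M N (f : M -> N) p q (u v : Tan p) :
  dif_at f p q (u + v) = dif_at f p q u + dif_at f p q v.
Proof. exact: linearD. Qed.

Lemma dif_atN M N (f : M -> N) p q (v : Tan p) :
  dif_at f p q (- v) = - dif_at f p q v.
Proof. exact: linearN. Qed.

Lemma dif_at_comp M N P (g : N -> P) (f : M -> N) p q r (v : Tan p) :
  smooth f -> smooth g -> f p = q -> g q = r ->
  dif_at g q r (dif_at f p q v) = dif_at (fun x => g (f x)) p r v.
Proof.
move=> sf sg fp gq; apply: Tan_ext => h.
have sgf := smooth_comp sg sf.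
rewrite (dif_atE sg gq) (dif_atE sf fp) (dif_atE sgf) ?fp //.
by congr (der v _); apply: Cinf_ext.
Qed.

Lemma dif_at_id M (p : M) (v : Tan p) : dif_at (fun x => x) p p v = v.
Proof.
apply: Tan_ext => h; rewrite (dif_atE (@smooth_id M)) //.
by congr (der v _); apply: Cinf_ext.
Qed.

Lemma dif_at_cst M N (p : M) (q : N) (v : Tan p) : dif_at (fun=> q) p q v = 0.
Proof.
apply: Tan_ext => h; rewrite (dif_atE (@smooth_cst M N q)) //.
exact: (@Tan_cst _ _ _ _ (h q)).
Qed.

Lemma dif_at_smooth M N (f : M -> N) p q :
  smooth (M := TanS p) (N := TanS q) (dif_at f p q).
Proof.
apply: smooth_gen => _ [h ->]; rewrite /dif_at.
(* In the second case [dif_at] takes its default value, a constant map. *)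
case: pselect => [H|_]; last exact: (smooth_real_cst (TanS p) 0).
by apply: generated_sub; exists (pullC (proj1 H) h).
Qed.

Lemma dif_comp M N P (g : N -> P) (f : M -> N) (v : TM M) :
  smooth f -> smooth g -> dif g (dif f v) = dif (fun x => g (f x)) v.
Proof.
by move=> sf sg; rewrite /dif /=; congr (tvec _); rewrite dif_at_comp.
Qed.

Lemma dif_id M (v : TM M) : dif (fun x => x) v = v.
Proof. by case: v => p v; rewrite /dif /= dif_at_id. Qed.

Lemma smooth_dif M N (f : M -> N) : smooth f -> smooth (dif f).
Proof.
move=> sf; apply: smooth_gen => _ [] [h ->] /=.
  apply: generated_sub; left; exists (pullC sf h) => //.
apply: generated_sub; right; exists (pullC sf h).
by apply: funext => v; rewrite (dif_atE sf).
Qed.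

Lemma smooth_Tan_addZ M N (q : N) (a : R) (f g : M -> TanS q) :
  smooth f -> smooth g ->
  smooth (N := TanS q) (fun x => (f x : Tan q) + a *: (g x : Tan q)).
Proof.
move=> sf sg; apply: smooth_gen => _ [h ->] /=.
have sh : smooth_real (fun v : TanS q => (v : Tan q) h).
  by apply: generated_sub; exists h.
by apply: smooth_real_addZ; [exact: (sf _ sh)|exact: (sg _ sh)].
Qed.

(* The smooth functions satisfying the identity contain the generators and are
stable under superposition and localisation, hence are all of them. *)
Lemma Tan_prod M N (p : M) (q : N) (w : Tan (M := prodS M N) (p, q))
    (F Fl Fr : Cinf (prodS M N)) :
  (forall x, Fl x = F (x.1, q)) -> (forall x, Fr x = F (p, x.2)) ->
  w F = w Fl + w Fr.
Proof.
have sl : smooth (M := prodS M N) (N := prodS M N) (fun x => (x.1, q)).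
  by apply: smooth_pair; [exact: smooth_fst|exact: smooth_cst].
have sr : smooth (M := prodS M N) (N := prodS M N) (fun x => (p, x.2)).
  by apply: smooth_pair; [exact: smooth_cst|exact: smooth_snd].
(* [w] acts on elements of [Cinf], so a proof of smoothness is carried along with the identity. *)
suff H : forall F : prodS M N -> R, smooth_real F ->
    exists sF : smooth_real F, w (MkCinf sF) =
      w (pullC sl (MkCinf sF)) + w (pullC sr (MkCinf sF)).
  move=> Fl_ Fr_; have [sF HF] := H F (cfunP F).
  have -> : F = MkCinf sF by apply: Cinf_ext.
  rewrite HF; congr (der w _ + der w _); apply: Cinf_ext; apply: funext => x.
  - by rewrite Fl_.
  - by rewrite Fr_.
move=> {F Fl Fr} F sF; have [wl wc] := derP w.
pose C (F : prodS M N -> R) := exists sF : smooth_real F, w (MkCinf sF) =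
  w (pullC sl (MkCinf sF)) + w (pullC sr (MkCinf sF)).
apply: (sF C) => {F sF}.
- move=> n h f sh Hf.
  pose sf i : smooth_real (s := prodS M N) (f i) := projT1 (cid (Hf i)).
  pose c i : Cinf (prodS M N) := MkCinf (sf i).
  have sg : smooth_real (s := prodS M N) (fun x => h (\row_i f i x)) by exact: smooth_realD.
  exists sg.
  rewrite (wc n h c) // (wc n h (fun i => pullC sl (c i))) //.
  rewrite [X in _ = _ + X](wc n h (fun i => pullC sr (c i))) //=.
  rewrite -big_split; apply: eq_bigr => i _ /=.
  by rewrite -mulrDr; congr (_ * _); exact: (projT2 (cid (Hf i))).
- move=> f Hf.
  have sf : smooth_real (s := prodS M N) f.
    apply: smooth_realL => x; have [g [sg _] [chi [schi _] H]] := Hf x.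
    by exists g => //; exists chi.
  exists sf; have [g [sg Hg] [chi [schi _] [chi0 H]]] := Hf (p, q).
  rewrite (wl (MkCinf sf) (MkCinf sg)); last by exists chi.
  rewrite Hg; congr (_ + _); apply: wl.
  - exists (fun x => chi (x.1, q)); first exact: (sl _ schi).
    by split=> // x /H.
  - exists (fun x => chi (p, x.2)); first exact: (sr _ schi).
    by split=> // x /H.
(* A function of one coordinate is constant along the other axis, and [w] kills constants. *)
- move=> f [] [g sg ->].
    exists (smooth_fst sg); rewrite [X in _ = _ + X](@Tan_cst _ _ _ _ (g p)) // addr0.
    by congr (der w _); apply: Cinf_ext.
  exists (smooth_snd sg); rewrite [X in _ = X + _](@Tan_cst _ _ _ _ (g q)) // add0r.
  by congr (der w _); apply: Cinf_ext.
Qed.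

End SmoothMaps.

(** * Groupoids and natural transformations *)

Section Lawful.
Variable R : realType.
Implicit Types D : gpd R.

(** The laws shared by E and L(G), stated through the relation [is_comp]. Smoothness of composition
    is required for smooth families, which avoids describing the space [gP]. *)
Record lawful D : Prop := Lawful {
  comp_pair : forall g f h : g1 D, is_comp g f h -> src g = tgt f;
  comp_st : forall g f h : g1 D, is_comp g f h -> src h = src f /\ tgt h = tgt g;
  comp_fun : forall g f h h' : g1 D, is_comp g f h -> is_comp g f h' -> h = h';
  comp_ex : forall g f : g1 D, src g = tgt f -> exists h, is_comp g f h;
  uni_st : forall x : g0 D, src (uni x) = x /\ tgt (uni x) = x;
  comp_unit : forall f : g1 D, is_comp f (uni (src f)) f /\ is_comp (uni (tgt f)) f f;
  comp_assoc : forall f g h fg gh k : g1 D,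
    is_comp g f fg -> is_comp h g gh -> is_comp h fg k -> is_comp gh f k;
  smooth_gcomp : forall (M : smoothSpace R) (a b : M -> g1 D), smooth a -> smooth b ->
    (forall x, src (b x) = tgt (a x)) -> smooth (fun x => gcomp (b x) (a x));
  smooth_uni : smooth (@uni R D) }.

Section LawfulTheory.
Variables (D : gpd R) (LD : lawful D).
Implicit Types f g h : g1 D.

Lemma gcompP g f h : is_comp g f h -> gcomp g f = h.
Proof.
move=> gfh; rewrite /gcomp; case: pselect => [H|[]]; last by exists h.
exact: (comp_fun LD (projT2 (cid H)) gfh).
Qed.

Lemma is_comp_gcomp g f : src g = tgt f -> is_comp g f (gcomp g f).
Proof. by move=> /(comp_ex LD)[h gfh]; rewrite (gcompP gfh). Qed.

Lemma src_gcomp g f : src g = tgt f -> src (gcomp g f) = src f.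
Proof. by move/is_comp_gcomp/(comp_st LD) => []. Qed.

Lemma tgt_gcomp g f : src g = tgt f -> tgt (gcomp g f) = tgt g.
Proof. by move/is_comp_gcomp/(comp_st LD) => []. Qed.

Lemma gcomp_unir f x : src f = x -> gcomp f (uni x) = f.
Proof. by move=> <-; apply: gcompP; case: (comp_unit LD f). Qed.

Lemma gcomp_unil f x : tgt f = x -> gcomp (uni x) f = f.
Proof. by move=> <-; apply: gcompP; case: (comp_unit LD f). Qed.

Lemma gcompA h g f : src g = tgt f -> src h = tgt g ->
  gcomp h (gcomp g f) = gcomp (gcomp h g) f.
Proof.
move=> gf hg; apply: esym; apply: gcompP.
apply: (comp_assoc LD (is_comp_gcomp gf) (is_comp_gcomp hg)).
by apply: is_comp_gcomp; rewrite tgt_gcomp.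
Qed.

End LawfulTheory.

Lemma mor_is_comp D D' (F : fpair D D') (g f h : g1 D) : is_mor F ->
  is_comp g f h -> is_comp (F.1 g) (F.1 f) (F.1 h).
Proof. by case=> _ _ _ H [w [<- <- <-]]; exact: H. Qed.

Lemma mor_id D : is_mor (fid D).
Proof. by split=> // [|w]; [split; exact: smooth_id|exists w]. Qed.

Lemma mor_comp D D' D'' (G : fpair D' D'') (F : fpair D D') :
  is_mor G -> is_mor F -> is_mor (fcomp G F).
Proof.
move=> mG mF; case: (mG) => [[G1 G2] Gst Gu _]; case: (mF) => [[F1 F2] Fst Fu Fc].
split=> /=.
- by split; [exact: (smooth_comp G1 F1)|exact: (smooth_comp G2 F2)].
- by move=> f /=; rewrite (Gst _).1 (Gst _).2 (Fst _).1 (Fst _).2.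
- by move=> x; rewrite Fu Gu.
- by move=> w; exact: (mor_is_comp mG (Fc w)).
Qed.

(** * Natural transformations and vertical composition *)

Section Transformations.
Variables (D D' : gpd R) (L' : lawful D').
Implicit Types (F : fpair D D') (eta : g0 D -> g1 D').

(** Composites in a lawful target are unique, and exist when the ends match; this turns the common
    composite [h] of [is_nat] into an equation. *)
Lemma natE F F' eta : is_mor F -> is_mor F' -> is_nat F F' eta <->
  [/\ smooth eta, forall x, src (eta x) = F.2 x /\ tgt (eta x) = F'.2 x
    & forall f, gcomp (eta (tgt f)) (F.1 f) = gcomp (F'.1 f) (eta (src f))].
Proof.
move=> [_ Fst _ _] [_ F'st _ _]; split=> -[sm st nat]; split=> // f.
  by have [h [/(gcompP L')-> /(gcompP L')->]] := nat f.
exists (gcomp (eta (tgt f)) (F.1 f)); split.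
  by apply: (is_comp_gcomp L'); rewrite (st _).1 (Fst _).2.
by rewrite nat; apply: (is_comp_gcomp L'); rewrite (st _).2 (F'st _).1.
Qed.

Lemma nat_id F : is_mor F -> is_nat F F (fun x => uni (F.2 x)).
Proof.
move=> mF; apply/natE => //; case: (mF) => [[F1 F2] Fst Fu _]; split.
- exact: (smooth_comp (smooth_uni L') F2).
- by move=> x; exact: (uni_st L').
- by move=> f; rewrite (gcomp_unil L') ?(Fst _).2 // (gcomp_unir L') // (Fst _).1.
Qed.

Lemma nat_vcomp F F' F'' eta eta' : is_mor F -> is_mor F' -> is_mor F'' ->
  is_nat F F' eta -> is_nat F' F'' eta' ->
  is_nat F F'' (fun x => gcomp (eta' x) (eta x)).
Proof.
move=> mF mF' mF'' /natE-/(_ mF mF')[sm st nat] /natE-/(_ mF' mF'')[sm' st' nat'].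
have pr x : src (eta' x) = tgt (eta x) by rewrite (st _).2 (st' _).1.
case: mF mF' mF'' (mF) (mF'') => _ Fst _ _ [_ F'st _ _] [_ F''st _ _] mF mF''.
apply/natE => //; split.
- exact: (smooth_gcomp L').
- by move=> x; rewrite (src_gcomp L') // (tgt_gcomp L') // (st _).1 (st' _).2.
- move=> f; rewrite -(gcompA L') //; last by rewrite (st _).1 (Fst _).2.
  rewrite nat (gcompA L'); first last.
  + by rewrite (st' _).1 (F'st _).2.
  + by rewrite (st _).2 (F'st _).1.
  by rewrite nat' (gcompA L') // (st' _).2 (F''st _).1.
Qed.

Lemma nt_ext (eta eta' : nt D D') : ndom eta = ndom eta' -> ncod eta = ncod eta' ->
  (forall x, eta x = eta' x) -> eta = eta'.
Proof.
by case: eta eta' => [F F' e] [H H' e'] /= -> -> ee'; congr Nt; apply: funext.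
Qed.

Definition ntrans (eta : nt D D') : Prop :=
  [/\ is_mor (ndom eta), is_mor (ncod eta) & is_nat (ndom eta) (ncod eta) eta].

Lemma ntrans_src (eta : nt D D') x : ntrans eta -> src (eta x) = (ndom eta).2 x.
Proof. by case=> _ _ [_ /(_ x)[]]. Qed.

Lemma ntrans_tgt (eta : nt D D') x : ntrans eta -> tgt (eta x) = (ncod eta).2 x.
Proof. by case=> _ _ [_ /(_ x)[]]. Qed.

Lemma ntrans_nat (eta : nt D D') f : ntrans eta ->
  gcomp (eta (tgt f)) ((ndom eta).1 f) = gcomp ((ncod eta).1 f) (eta (src f)).
Proof. by case=> mF mF' /natE-/(_ mF mF')[]. Qed.

Lemma ntrans_nid F : is_mor F -> ntrans (nid F).
Proof. by move=> mF; split=> //; exact: nat_id. Qed.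

Lemma ntrans_vcomp (eta eta' : nt D D') : ntrans eta -> ntrans eta' ->
  ndom eta' = ncod eta -> ntrans (vcomp eta' eta).
Proof.
move=> [mF mF' nn] [_ mF'' n'] e; rewrite e in n'.
by split=> //=; apply: nat_vcomp n'.
Qed.

Lemma vcomp_nidr (eta : nt D D') : ntrans eta -> vcomp eta (nid (ndom eta)) = eta.
Proof.
by move=> ne; apply: nt_ext => // x /=; rewrite (gcomp_unir L') // ntrans_src.
Qed.

Lemma vcomp_nidl (eta : nt D D') : ntrans eta -> vcomp (nid (ncod eta)) eta = eta.
Proof.
by move=> ne; apply: nt_ext => // x /=; rewrite (gcomp_unil L') // ntrans_tgt.
Qed.

Lemma vcompA (eta eta' eta'' : nt D D') : ntrans eta -> ntrans eta' ->
  ntrans eta'' -> ndom eta' = ncod eta -> ndom eta'' = ncod eta' ->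
  vcomp eta'' (vcomp eta' eta) = vcomp (vcomp eta'' eta') eta.
Proof.
move=> n n' n'' e e'; apply: nt_ext => // x /=.
by rewrite (gcompA L') // ntrans_src // ntrans_tgt // ?e ?e'.
Qed.

End Transformations.

(** * Horizontal composition and the interchange law *)

Section Horizontal.
Variables (D D' D'' : gpd R) (L'' : lawful D'').

(* D' need not be lawful: the tangent groupoid of E is only known to have
those compositions which come from smooth families of compositions in E. *)
Lemma ntrans_hcomp (zeta : nt D' D'') (eta : nt D D') : ntrans zeta ->
  ntrans eta -> ntrans (hcomp zeta eta).
Proof.
move=> nz ne; case: (ne) => mF mF' [sm st nat]; case: (nz) => mG mG' [sz _ _].
case: (mF) => _ Fst _ _; case: (mF') => [[_ sF'] F'st _ _].
case: (mG) => [[sG _] Gst _ _]; case: (mG') => [_ G'st _ _].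
have pr x : src (zeta ((ncod eta).2 x)) = tgt ((ndom zeta).1 (eta x)).
  by rewrite (ntrans_src _ nz) (Gst _).2 (st _).2.
have mGF := mor_comp mG mF; have mGF' := mor_comp mG' mF'.
split=> //; apply/(natE L'' _ mGF mGF'); split.
- apply: (smooth_gcomp L'') => //; first exact: (smooth_comp sG sm).
  exact: (smooth_comp sz sF').
- move=> x /=; rewrite (src_gcomp L'') // (tgt_gcomp L'') //.
  by rewrite (Gst _).1 (st _).1 (ntrans_tgt _ nz).
- move=> f /=; have [h [h1 h2]] := nat f.
  have {}h1 := mor_is_comp mG h1; have {}h2 := mor_is_comp mG h2.
  rewrite -(gcompA L'') //; last exact: (comp_pair L'' h1).
  rewrite (gcompP L'' h1) -(gcompP L'' h2) (gcompA L'').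
  + rewrite -(F'st _).2 (ntrans_nat L'') // (F'st _).1 (gcompA L'') //.
    by rewrite (ntrans_tgt _ nz) (G'st _).1 (F'st _).1.
  + exact: (comp_pair L'' h2).
  + by rewrite (ntrans_src _ nz) (Gst _).2 (F'st _).2.
Qed.

Lemma hcomp_nid (G : fpair D' D'') (F : fpair D D') : is_mor G ->
  hcomp (nid G) (nid F) = nid (fcomp G F).
Proof.
case=> _ _ Gu _; apply: nt_ext => // x /=.
by rewrite Gu (gcomp_unil L'') // (uni_st L'' _).2.
Qed.

(** [eta''] stands for the vertical composite of [eta'] and [eta], specified only through [is_comp]:
    this is what is available when [D'] is the tangent groupoid of E. *)
Lemma hcomp_vcomp (zeta zeta' : nt D' D'') (eta eta' eta'' : nt D D') :
  ntrans zeta -> ntrans zeta' -> ndom zeta' = ncod zeta ->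
  ntrans eta -> ntrans eta' -> ndom eta' = ncod eta ->
  ndom eta'' = ndom eta -> ncod eta'' = ncod eta' ->
  (forall x, is_comp (eta' x) (eta x) (eta'' x)) ->
  hcomp (vcomp zeta' zeta) eta'' = vcomp (hcomp zeta' eta') (hcomp zeta eta).
Proof.
move=> nz nz' ez ne ne' ee d'' c'' e''.
apply: nt_ext => [|| x]; rewrite /= ?d'' ?c'' //.
have mG : is_mor (ndom zeta) by case: nz.
case: (mG) => _ Gst _ _; have [_ [_ G'st _ _] _] := nz.
rewrite -(gcompP L'' (mor_is_comp mG (e'' x))) ez.
have p1 : src (eta' x) = (ncod eta).2 x by rewrite (ntrans_src _ ne') ee.
have p2 := ntrans_tgt x ne'.
have p3 := ntrans_tgt x ne.
have q1 y : src (zeta' y) = tgt (zeta y) by rewrite ntrans_src // ntrans_tgt // ez.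
(* Naturality of [zeta] at the arrow [eta' x] exchanges the two middle factors of the fourfold
   composite. *)
have nat := ntrans_nat L'' (eta' x) nz; rewrite p1 p2 in nat.
have c1 : src ((ndom zeta).1 (eta' x)) = tgt ((ndom zeta).1 (eta x)).
  by rewrite (Gst _).1 (Gst _).2 p1 p3.
have c2 : src (zeta ((ncod eta').2 x)) = tgt ((ndom zeta).1 (eta' x)).
  by rewrite (Gst _).2 ntrans_src // p2.
have c3 : src ((ncod zeta).1 (eta' x)) = tgt (zeta ((ncod eta).2 x)).
  by rewrite (G'st _).1 ntrans_tgt // p1.
have c4 : src (zeta ((ncod eta).2 x)) = tgt ((ndom zeta).1 (eta x)).
  by rewrite (Gst _).2 ntrans_src // p3.
have c5 : src (zeta' ((ncod eta').2 x)) = tgt ((ncod zeta).1 (eta' x)).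
  by rewrite (G'st _).2 ntrans_src // p2 ez.
rewrite (gcompA L'' c1); last by rewrite (src_gcomp L'').
rewrite -(gcompA L'' c2) // nat (gcompA L'' c3 c5).
by rewrite -(gcompA L'' c4) // (src_gcomp L'').
Qed.

End Horizontal.

(** As in [hcomp_vcomp], the composite [kappa] of [eta] and [theta] is known only through [is_comp].
    Functoriality of [ndom zeta] moves it to [D'''], where composition is associative. *)
Lemma hcompA (D D' D'' D''' : gpd R) (L : lawful D''') (zeta : nt D'' D''')
    (eta : nt D' D'') (theta : nt D D') (kappa : nt D D'') :
  ntrans zeta -> ntrans eta -> ntrans theta ->
  ndom kappa = fcomp (ndom eta) (ndom theta) ->
  ncod kappa = fcomp (ncod eta) (ncod theta) ->
  (forall x, is_comp (eta ((ncod theta).2 x)) ((ndom eta).1 (theta x)) (kappa x)) ->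
  hcomp zeta kappa = hcomp (hcomp zeta eta) theta.
Proof.
move=> nz ne nt dk ck k; apply: nt_ext => [|| x]; rewrite /= ?dk ?ck //=.
have mZ : is_mor (ndom zeta) by case: nz.
have c := mor_is_comp mZ (k x).
rewrite -(gcompP L c) (gcompA L) //; first exact: (comp_pair L c).
by case: (mZ) => _ Zst _ _; rewrite (Zst _).2 ntrans_src // ntrans_tgt.
Qed.

End Lawful.

(** * Lie groupoids and compositions in their tangent groupoids *)

Section LieGroupoids.
Variable R : realType.

Lemma is_comp_prod (D D' : gpd R) (g f h : g1 D) (g' f' h' : g1 D') :
  is_comp g f h -> is_comp g' f' h' ->
  is_comp (D := prodG D D') (g, g') (f, f') (h, h').
Proof. by move=> [w [<- <- <-]] [w' [<- <- <-]]; exists (w, w'). Qed.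

Variable E : lieGroupoid R.

Lemma smooth_src : smooth (@src R E). Proof. by case: (lgs_sub E) => -[]. Qed.
Lemma smooth_tgt : smooth (@tgt R E). Proof. by case: (lgt_sub E) => -[]. Qed.
Lemma smooth_lgu : smooth (@uni R E). Proof. exact: lgu_sm. Qed.
Lemma smooth_inv : smooth (@inv R E). Proof. exact: lgi_sm. Qed.
Lemma smooth_cmp : smooth (@cmp R E). Proof. exact: lgm_sm. Qed.

Lemma smooth_pr1 : smooth (@pr1 R E).
Proof. exact: (smooth_comp (@smooth_fst _ _ _) (@smooth_sval _ _ _)). Qed.

Lemma smooth_pr2 : smooth (@pr2 R E).
Proof. exact: (smooth_comp (@smooth_snd _ _ _) (@smooth_sval _ _ _)). Qed.

(** The arguments follow the order of the composite [g o f], whereas the pair lists the arrow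
    applied first. *)
Definition pairE (g f : g1 E) (H : tgt f = src g) : gP E := exist _ (f, g) H.

Lemma gP_ext (w w' : gP E) : pr1 w = pr1 w' -> pr2 w = pr2 w' -> w = w'.
Proof.
by case: w w' => [[x y] p] [[x' y'] p'] /= ? ?; subst; congr exist; exact: Prop_irrelevance.
Qed.

Lemma smooth_pairE (M : smoothSpace R) (a b : M -> g1 E)
    (H : forall x, tgt (a x) = src (b x)) :
  smooth a -> smooth b -> smooth (fun x => pairE (H x)).
Proof. by move=> sa sb; apply: smooth_sub; exact: smooth_pair. Qed.

Lemma gP_pair (w : gP E) : tgt (pr1 w) = src (pr2 w).
Proof. by case: w. Qed.

Lemma lawful_lie : lawful E.
Proof.
have fn (g f h h' : g1 E) : is_comp g f h -> is_comp g f h' -> h = h'.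
  move=> [w [p1 p2 <-]] [w' [p1' p2' <-]].
  by rewrite (@gP_ext w w') ?p1 ?p2.
have cmpP (w : gP E) : gcomp (pr2 w) (pr1 w) = cmp w.
  rewrite /gcomp; case: pselect => [H|[]]; last by exists (cmp w), w.
  by apply: (fn _ _ _ _ (projT2 (cid H))); exists w.
split=> //.
- by move=> g f h [w [<- <- _]]; rewrite gP_pair.
- by move=> g f h [w [<- <- <-]]; exact: lgm_st.
- by move=> g f H; exists (cmp (pairE (esym H))), (pairE (esym H)).
- exact: lgu_st.
- exact: lg_unit.
- exact: lg_assoc.
- move=> M a b sa sb H.
  have H' x : tgt (a x) = src (b x) by rewrite H.
  rewrite (_ : (fun x => _) = fun x => cmp (pairE (H' x))).
    exact: (smooth_comp smooth_cmp (smooth_pairE H' sa sb)).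
  by apply: funext => x; rewrite -cmpP.
- exact: smooth_lgu.
Qed.

Lemma gcomp_invr (f : g1 E) : gcomp f (inv f) = uni (tgt f).
Proof. by apply: (gcompP lawful_lie); case: (lg_inv f). Qed.

Lemma gcomp_invl (f : g1 E) : gcomp (inv f) f = uni (src f).
Proof. by apply: (gcompP lawful_lie); case: (lg_inv f). Qed.

(** Cancellation: [k = k o (f o inv f) = (k o f) o inv f = inv f]. *)
Lemma inv_unique (f k : g1 E) : src k = tgt f -> gcomp k f = uni (src f) ->
  k = inv f.
Proof.
move=> kf e; have [s t] := lgi_st f.
rewrite -(gcomp_unir lawful_lie kf) -gcomp_invr (gcompA lawful_lie) //.
by rewrite e (gcomp_unil lawful_lie).
Qed.

(** A smooth family of composable pairs is a single smooth map into [gP E], and its differential at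
    [v] is the witness that composition in [TG E] asks for. *)
Lemma is_comp_TG (M : smoothSpace R) (a b c : M -> g1 E) (v : TM M) :
  smooth a -> smooth b -> (forall x, is_comp (b x) (a x) (c x)) ->
  is_comp (D := TG E) (dif b v) (dif a v) (dif c v).
Proof.
move=> sa sb H; have H' x : tgt (a x) = src (b x).
  by rewrite (comp_pair lawful_lie (H x)).
have sw := smooth_pairE H' sa sb.
exists (dif (fun x => pairE (H' x)) v); split.
- by rewrite [LHS]dif_comp //; exact: smooth_pr1.
- by rewrite [LHS]dif_comp //; exact: smooth_pr2.
- rewrite [LHS]dif_comp //; last exact: smooth_cmp.
  congr dif; apply: funext => x; apply: (comp_fun lawful_lie) (H x).
  by exists (pairE (H' x)).
Qed.

End LieGroupoids.

(** * Differentials of functors and of natural transformations *)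

Lemma mor_Tfun (R : realType) (E E' : lieGroupoid R) (F : fpair E E') :
  is_mor F -> is_mor (Tfun F).
Proof.
move=> mF; case: (mF) => [[F1 F2] Fst Fu Fc]; split=> /=.
- by split; exact: smooth_dif.
- move=> f; have s := @smooth_src _ E; have s' := @smooth_src _ E'.
  have t := @smooth_tgt _ E; have t' := @smooth_tgt _ E'; rewrite !dif_comp //.
  by split; congr dif; apply: funext => x; case: (Fst x).
- move=> x; have s := @smooth_lgu _ E; have s' := @smooth_lgu _ E'; rewrite !dif_comp //.
  by congr dif; apply: funext => y; rewrite Fu.
- move=> w; have s1 := @smooth_pr1 _ E; have s2 := @smooth_pr2 _ E.
  have sc := @smooth_cmp _ E; rewrite !dif_comp //.
  (* Functoriality of [F] is itself a smooth family of compositions, indexed by [gP E]. *)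
  apply: is_comp_TG => [||x]; last exact: Fc.
  + exact: (smooth_comp F1 s1).
  + exact: (smooth_comp F1 s2).
Qed.

Lemma ntrans_Tnt (R : realType) (E E' : lieGroupoid R) (eta : nt E E') :
  ntrans eta -> ntrans (Tnt eta).
Proof.
case=> mF mF' [sm st nat]; split=> /=; [exact: mor_Tfun|exact: mor_Tfun|].
case: (mF) => [[F1 F2] Fst Fu Fc]; case: (mF') => [[F1' F2'] Fst' _ _].
split.
- exact: smooth_dif.
- move=> x; have s := @smooth_src _ E'; have t := @smooth_tgt _ E'.
  by rewrite /= !dif_comp //; split; congr dif; apply: funext => y; case: (st y).
- move=> f; have s := @smooth_src _ E; have t := @smooth_tgt _ E.
  (* The diagonals of the naturality squares, as one function of the arrow, so that both
     factorisations can be differentiated. *)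
  pose h x := gcomp (eta (tgt x)) ((ndom eta).1 x).
  have H x : is_comp (eta (tgt x)) ((ndom eta).1 x) (h x) /\
             is_comp ((ncod eta).1 x) (eta (src x)) (h x).
    by have [k [k1 k2]] := nat x; rewrite /h (gcompP (lawful_lie E') k1).
  exists (dif h f); rewrite /= !dif_comp //; split; apply: is_comp_TG => //.
  + exact: (smooth_comp sm t).
  + by move=> x; case: (H x).
  + exact: (smooth_comp sm s).
  + by move=> x; case: (H x).
Qed.

Lemma Tnt_nid (R : realType) (E E' : lieGroupoid R) (F : fpair E E') :
  is_mor F -> Tnt (nid F) = nid (Tfun F).
Proof.
case=> [[F1 F2] _ _ _]; apply: nt_ext => // x /=.
by rewrite dif_comp //; exact: smooth_lgu.
Qed.

Lemma Tfun_comp (R : realType) (E E' E'' : lieGroupoid R) (G : fpair E' E'')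
    (F : fpair E E') : is_mor G -> is_mor F ->
  Tfun (fcomp G F) = fcomp (Tfun G) (Tfun F).
Proof.
case=> [[G1 G2] _ _ _] [[F1 F2] _ _ _]; rewrite /Tfun /fcomp /=.
by congr pair; apply: funext => v /=; rewrite dif_comp.
Qed.

Lemma Tfun_id (R : realType) (E : lieGroupoid R) : Tfun (fid E) = fid (TG E).
Proof. by congr pair; apply: funext => v; rewrite /= dif_id. Qed.

(** * The Lie 2-algebra of a Lie 2-group *)

Section LieAlgebra.
Variables (R : realType) (G : lie2group R).
Notation e0 := (gone (op0 G)).
Notation e1 := (gone (op1 G)).
Notation m0 := (gmul (op0 G)).
Notation m1 := (gmul (op1 G)).
Notation i0 := (ginv (op0 G)).
Notation i1 := (ginv (op1 G)).
Implicit Types (x y z : g1 G) (k : g0 G).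

Lemma mul1A x y z : m1 x (m1 y z) = m1 (m1 x y) z.
Proof. by have [_ [_ _ H _ _] _ _] := op1P G; apply: H. Qed.
Lemma mul1e x : m1 x e1 = x.
Proof. by have [_ [_ _ _ H _] _ _] := op1P G; case: (H x). Qed.
Lemma mule1 x : m1 e1 x = x.
Proof. by have [_ [_ _ _ H _] _ _] := op1P G; case: (H x). Qed.
Lemma mulV1 x : m1 (i1 x) x = e1.
Proof. by have [_ [_ _ _ _ H] _ _] := op1P G; case: (H x). Qed.
Lemma mul1V x : m1 x (i1 x) = e1.
Proof. by have [_ [_ _ _ _ H] _ _] := op1P G; case: (H x). Qed.
Lemma mulV0 k : m0 (i0 k) k = e0.
Proof. by have [_ [_ _ _ _ H] _ _] := op0P G; case: (H k). Qed.
Lemma mul0V k : m0 k (i0 k) = e0.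
Proof. by have [_ [_ _ _ _ H] _ _] := op0P G; case: (H k). Qed.

Lemma src_mul x y : src (m1 x y) = m0 (src x) (src y).
Proof. by have [_ H _ _] := l2_mul G; case: (H (x, y)). Qed.
Lemma tgt_mul x y : tgt (m1 x y) = m0 (tgt x) (tgt y).
Proof. by have [_ H _ _] := l2_mul G; case: (H (x, y)). Qed.
Lemma uni_mul k k' : uni (m0 k k') = m1 (uni k) (uni k').
Proof. by have [_ _ H _] := l2_mul G; exact: (esym (H (k, k'))). Qed.
Lemma uni_inv k : uni (i0 k) = i1 (uni k).
Proof. by have [_ _ H _] := l2_inv G; exact: (esym (H k)). Qed.
Lemma src_one : src e1 = e0. Proof. by case: (l2_one G). Qed.
Lemma tgt_one : tgt e1 = e0. Proof. by case: (l2_one G). Qed.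
Lemma uni_one : uni e0 = e1. Proof. by case: (l2_one G). Qed.

Lemma inv1_one : i1 e1 = e1.
Proof. by rewrite -[LHS]mul1e mulV1. Qed.

Lemma smooth_mul1 : smooth (fun x : prodS (g1 G) (g1 G) => m1 x.1 x.2).
Proof. by case: (op1P G). Qed.
Lemma smooth_inv1 : smooth i1. Proof. by case: (op1P G). Qed.

(* Interchange applied to [y = (y 1) o (1_z (1_z^-1 x))], where
[z = s(y) = t(x)]. *)
Lemma cmp_mul (w : gP G) :
  cmp w = m1 (pr2 w) (m1 (i1 (uni (src (pr2 w)))) (pr1 w)).
Proof.
set x := pr1 w; set y := pr2 w.
have xy : tgt x = src y by exact: gP_pair.
set v := m1 _ x.
have tv : uni (tgt v) = e1.
  by rewrite /v tgt_mul -uni_inv (lgu_st _).2 xy mulV0 uni_one.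
have cy := (lg_unit y).1; have cv := (lg_unit v).2; rewrite tv in cv.
have := mor_is_comp (l2_mul G) (is_comp_prod cy cv).
rewrite /= mul1e /v mul1A mul1V mule1 => H.
apply: (comp_fun (lawful_lie G)) H.
by exists w.
Qed.

(** The vector [v] is pushed to the pair of units, where [Tan_prod] splits it along the two axes; on
    each axis the unit laws turn multiplication into a projection. *)
Lemma dif_mul (M : smoothSpace R) (a b : M -> g1 G) (p : M) (v : Tan p) :
  smooth a -> smooth b -> a p = e1 -> b p = e1 ->
  dif_at (fun q => m1 (a q) (b q)) p e1 v = dif_at a p e1 v + dif_at b p e1 v.
Proof.
move=> sa sb ap bp; apply: Tan_ext => h.
have sab := smooth_pair sa sb.
have abp : (a p, b p) = (e1, e1) by rewrite ap bp.
have sm := smooth_comp smooth_mul1 sab.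
rewrite (dif_atE sm) /= ?ap ?bp ?mul1e // (dif_atE sa) // (dif_atE sb) //.
have := @Tan_prod _ _ _ _ _ (dif_at (N := prodS (g1 G) (g1 G)) (fun q => (a q, b q)) p (e1, e1) v)
 (pullC smooth_mul1 h) (pullC (@smooth_fst _ _ _) h) (pullC (@smooth_snd _ _ _) h).
rewrite !(dif_atE sab abp) => H.
transitivity (v (pullC sab (pullC smooth_mul1 h))).
  by congr (der v _); apply: Cinf_ext.
rewrite H => [|x|x]; last 2 first.
- by rewrite /= mul1e.
- by rewrite /= mule1.
by congr (_ + _); congr (der v _); apply: Cinf_ext.
Qed.

(** The product rule for the constant function [m1 (i1 (a q)) (a q)]. *)
Lemma dif_inv (M : smoothSpace R) (a : M -> g1 G) (p : M) (v : Tan p) :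
  smooth a -> a p = e1 ->
  dif_at (fun q => i1 (a q)) p e1 v = - dif_at a p e1 v.
Proof.
move=> sa ap; have sia := smooth_comp smooth_inv1 sa.
apply/eqP; rewrite -subr_eq0 opprK -dif_mul ?ap ?inv1_one //; apply/eqP.
rewrite -(dif_at_cst e1 v); apply: eq_dif_at => q.
by rewrite mulV1.
Qed.

Notation S := (dif_at (@src R G) e1 e0).
Notation T := (dif_at (@tgt R G) e1 e0).
Notation U := (dif_at (@uni R G) e0 e1).
Implicit Types (a b h : Tan e1).

Let ss := @smooth_src _ G.
Let st := @smooth_tgt _ G.
Let su := @smooth_lgu _ G.

(** The product rule applied to the formula [cmp_mul]. *)
Lemma cmp_LG (w : Tan (oneP G)) :
  dif_at (@cmp R G) (oneP G) e1 w =
  dif_at (@pr2 R G) (oneP G) e1 w +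
  (dif_at (@pr1 R G) (oneP G) e1 w - U (S (dif_at (@pr2 R G) (oneP G) e1 w))).
Proof.
have s1 := @smooth_pr1 _ G; have s2 := @smooth_pr2 _ G.
rewrite (_ : @cmp R G = fun w => m1 (pr2 w) (m1 (i1 (uni (src (pr2 w)))) (pr1 w))).
  have s3 := smooth_comp su (smooth_comp ss s2).
  have s4 := smooth_comp smooth_inv1 s3.
  have e1' : pr1 (oneP G) = e1 by [].
  have e2 : pr2 (oneP G) = e1 by [].
  have e3 : src (pr2 (oneP G)) = e0 by rewrite e2 src_one.
  have e4 : uni (src (pr2 (oneP G))) = e1 by rewrite e3 uni_one.
  have s5 := smooth_comp smooth_mul1 (smooth_pair s4 s1).
  rewrite dif_mul ?e4 ?inv1_one ?e1' ?mul1e // dif_mul ?e4 ?inv1_one //.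
  rewrite dif_inv //.
  rewrite (dif_at_comp _ s2 ss e2 src_one).
  rewrite (dif_at_comp _ (smooth_comp ss s2) su e3 uni_one).
  by rewrite [- _ + _]addrC.
by apply: funext => w'; exact: cmp_mul.
Qed.

(** This replaces the composable pairs of L(G), defined as a tangent space of [gP G], by linear
    algebra. *)
Lemma is_comp_LG a b h :
  is_comp (D := LG G) b a h <-> S b = T a /\ h = b + (a - U (S b)).
Proof.
have s1 := @smooth_pr1 _ G; have s2 := @smooth_pr2 _ G.
split=> [[w /= [<- <- <-]]|[ba ->]].
  rewrite cmp_LG; split=> //.
  have e1' : pr1 (oneP G) = e1 by [].
  have e2 : pr2 (oneP G) = e1 by [].
  rewrite (dif_at_comp _ s2 ss e2 src_one) (dif_at_comp _ s1 st e1' tgt_one).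
  by apply: eq_dif_at => w'; rewrite gP_pair.
(* A pair with [S b = T a] has to be realised by a tangent vector at [oneP G]. It is the sum of the
   differentials of [x |-> (x, 1_(t x))] at [a] and of [y |-> (e, y 1_(s y)^-1)] at [b]: the first
   components add up to [a], the second to [U (T a) + b - U (S b) = b]. *)
have H1 x : tgt x = src (uni (tgt x) : g1 G) by rewrite (lgu_st _).1.
have H2 y : tgt e1 = src (m1 y (i1 (uni (src y)))).
  by rewrite src_mul -uni_inv (lgu_st _).1 mul0V tgt_one.
have sb : smooth (fun y : g1 G => i1 (uni (src y))).
  exact: (smooth_comp smooth_inv1 (smooth_comp su ss)).
have sB : smooth (fun y : g1 G => m1 y (i1 (uni (src y)))).
  exact: (smooth_comp smooth_mul1 (smooth_pair (@smooth_id _ _) sb)).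
have sA : smooth (fun x : g1 G => (uni (tgt x) : g1 G)) by exact: (smooth_comp su st).
have S1 := smooth_pairE H1 (@smooth_id _ _) sA.
have S2 := smooth_pairE H2 (@smooth_cst _ _ _ _) sB.
have v1 : uni (tgt e1) = e1 by rewrite tgt_one uni_one.
have v2 : uni (src e1) = e1 by rewrite src_one uni_one.
have P1 : pairE (H1 e1) = oneP G by apply: gP_ext.
have P2 : pairE (H2 e1) = oneP G.
  apply: gP_ext => //; transitivity (m1 e1 (i1 (uni (src e1)))) => //.
  by rewrite v2 inv1_one mul1e.
pose w : Tan (oneP G) := dif_at (fun x => pairE (H1 x)) e1 (oneP G) a +
  dif_at (fun x => pairE (H2 x)) e1 (oneP G) b.
have w1 : dif_at (@pr1 R G) (oneP G) e1 w = a.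
  rewrite /w dif_atD (dif_at_comp _ S1 s1 P1) // (dif_at_comp _ S2 s1 P2) //.
  by rewrite [X in X + _]dif_at_id [X in _ + X]dif_at_cst addr0.
have w2 : dif_at (@pr2 R G) (oneP G) e1 w = b.
  rewrite /w dif_atD (dif_at_comp _ S1 s2 P1) // (dif_at_comp _ S2 s2 P2) //.
  rewrite [X in _ + X]dif_mul ?v2 ?inv1_one // dif_at_id.
  rewrite dif_inv ?v2 //; last exact: (smooth_comp su ss).
  rewrite -(dif_at_comp _ ss su src_one uni_one).
  rewrite -(dif_at_comp _ st su tgt_one uni_one) ba.
  by rewrite addrC subrK.
by exists w; split=> //=; rewrite cmp_LG w1 w2.
Qed.

Lemma S_U (B : Tan e0) : S (U B) = B.
Proof.
rewrite (dif_at_comp _ su ss uni_one src_one) -[RHS]dif_at_id.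
by apply: eq_dif_at => k; rewrite (lgu_st _).1.
Qed.

Lemma T_U (B : Tan e0) : T (U B) = B.
Proof.
rewrite (dif_at_comp _ su st uni_one tgt_one) -[RHS]dif_at_id.
by apply: eq_dif_at => k; rewrite (lgu_st _).2.
Qed.

Lemma gcomp_LG a b : S b = T a ->
  gcomp (D := LG G) b a = b + (a - U (S b)).
Proof.
move=> ba; rewrite /gcomp; case: pselect => [H|[]].
  by case: cid => h /= /is_comp_LG[].
by exists (b + (a - U (S b))); apply/is_comp_LG.
Qed.

(** Through [is_comp_LG] the algebraic laws become linear identities, resting on [S_U] and [T_U]. *)
Lemma lawful_LG : lawful (LG G).
Proof.
split=> /=.
- by move=> g f h /is_comp_LG[].
- move=> g f h /is_comp_LG[gf ->]; rewrite !dif_atD !dif_atN S_U T_U gf.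
  by rewrite -gf addrC subrK gf subrr addr0.
- by move=> g f h h' /is_comp_LG[_ ->] /is_comp_LG[_ ->].
- by move=> g f gf; exists (g + (f - U (S g))); apply/is_comp_LG.
- by move=> x; rewrite S_U T_U.
- move=> f; split; apply/is_comp_LG; rewrite ?S_U ?T_U; split=> //.
    by rewrite subrr addr0.
  by rewrite addrC subrK.
- move=> f g h fg gh k /is_comp_LG[gf ->] /is_comp_LG[hg ->] /is_comp_LG[_ ->].
  apply/is_comp_LG; split; rewrite !dif_atD !dif_atN S_U hg.
    by rewrite -hg addrC subrK gf.
  rewrite [U (T g) + _]addrC subrK -!addrA; congr (h + (g + _)).
  by rewrite addrA addrC.
(* The formula [b + (a - U (S b))], written as two nested instances of [smooth_Tan_addZ]. *)
- move=> M a b sa sb ab; have := smooth_Tan_addZ 1 sb (smooth_Tan_addZ (-1) sa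
    (smooth_comp (@dif_at_smooth _ _ _ (@uni R G) e0 e1)
      (smooth_comp (@dif_at_smooth _ _ _ (@src R G) e1 e0) sb))).
  congr smooth; apply: funext => x; rewrite gcomp_LG //.
  by rewrite scale1r scaleN1r.
- exact: dif_at_smooth.
Qed.

End LieAlgebra.

(** * Adjoint actions *)

Section GroupOf.
Variables (T : Type) (A : set T).

(** Existence of two-sided inverses suffices: [group_of] chooses one, and its default value is never
    taken on [A]. *)
Lemma is_group_of (mul : T -> T -> T) (one : T) :
  A one -> (forall x y, A x -> A y -> A (mul x y)) ->
  (forall x y z, A x -> A y -> A z -> mul x (mul y z) = mul (mul x y) z) ->
  (forall x, A x -> mul one x = x /\ mul x one = x) ->
  (forall x, A x -> exists y, [/\ A y, mul x y = one & mul y x = one]) ->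
  is_group A (group_of A mul one).
Proof.
move=> A1 AM MA M1 MV; split=> //= x Ax.
case: pselect => [H|[]]; last exact: MV.
by case: cid => y [].
Qed.

Variable o : groupOps T.
Hypothesis Ao : is_group A o.

Lemma ginv_closed x : A x -> A (ginv o x).
Proof. by case: Ao => _ _ _ _ H /H[]. Qed.

(** Inverses are identified below by exhibiting a right inverse inside [A]. *)
Lemma ginv_uniq x y : A x -> A y -> gmul o x y = gone o -> ginv o x = y.
Proof.
case: Ao => A1 AM MA M1 MV Ax Ay xy; have [Ai ix xi] := MV _ Ax.
by rewrite -(M1 _ Ai).2 -xy MA // ix (M1 _ Ay).1.
Qed.

Lemma ginv_one : ginv o (gone o) = gone o.
Proof. by case: (Ao) => A1 _ _ M1 _; apply: ginv_uniq => //; case: (M1 _ A1). Qed.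

Lemma ginv_mul x y : A x -> A y ->
  ginv o (gmul o x y) = gmul o (ginv o y) (ginv o x).
Proof.
case: (Ao) => A1 AM MA M1 MV Ax Ay.
have [Ai _ xi] := MV _ Ax; have [Aj _ yj] := MV _ Ay.
apply: ginv_uniq; [exact: AM|exact: AM|].
by rewrite -MA ?[gmul o y (gmul _ _ _)]MA ?yj ?(M1 _ Ai).1 //; exact: AM.
Qed.

End GroupOf.

(** * Equivariance and linearity of composites in the Lie 2-algebra *)

Section Adjoint.
Variables (R : realType) (G : lie2group R).
Notation e0 := (gone (op0 G)).
Notation e1 := (gone (op1 G)).
Notation S := (dif_at (@src R G) e1 e0).
Notation T := (dif_at (@tgt R G) e1 e0).
Notation U := (dif_at (@uni R G) e0 e1).

Lemma smooth_conj (M : smoothSpace R) (o : groupOps M) (g : M) : is_lie_group o ->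
  smooth (fun h => gmul o (gmul o g h) (ginv o g)).
Proof.
case=> _ _ sm _.
have s1 := smooth_comp sm (smooth_pair (@smooth_cst _ M _ g) (@smooth_id _ M)).
exact: (smooth_comp sm (smooth_pair s1 (@smooth_cst _ M _ (ginv o g)))).
Qed.

Lemma conj_one (M : Type) (o : groupOps M) (g : M) : is_group setT o ->
  gmul o (gmul o g (gone o)) (ginv o g) = gone o.
Proof. by case=> _ _ _ M1 MV; rewrite (M1 g I).2; case: (MV g I). Qed.

Lemma conj0_one k : gmul (op0 G) (gmul (op0 G) k e0) (ginv (op0 G) k) = e0.
Proof. by apply: conj_one; case: (op0P G). Qed.

Lemma conj1_one k : gmul (op1 G) (gmul (op1 G) k e1) (ginv (op1 G) k) = e1.
Proof. by apply: conj_one; case: (op1P G). Qed.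

(** The unit map is a homomorphism, so it intertwines conjugation by [k] with conjugation by
    [uni k]; this is differentiated at the unit. [S_Ad] and [T_Ad] arise likewise, [k] being both
    source and target of [uni k]. *)
Lemma U_Ad (k : g0 G) (B : Tan e0) :
  U (Ad (o := op0 G) k B) = Ad (o := op1 G) (uni k) (U B).
Proof.
have c0 := smooth_conj k (op0P G); have c1 := smooth_conj (uni k) (op1P G).
have su := @smooth_lgu _ G.
rewrite /Ad (dif_at_comp _ c0 su (conj0_one k) (uni_one G)).
rewrite (dif_at_comp _ su c1 (uni_one G) (conj1_one _)).
by apply: eq_dif_at => h; rewrite !uni_mul uni_inv.
Qed.

Lemma S_Ad (k : g0 G) (b : Tan e1) :
  S (Ad (o := op1 G) (uni k) b) = Ad (o := op0 G) k (S b).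
Proof.
have c0 := smooth_conj k (op0P G); have c1 := smooth_conj (uni k) (op1P G).
have ss := @smooth_src _ G.
rewrite /Ad (dif_at_comp _ c1 ss (conj1_one _) (src_one G)).
rewrite (dif_at_comp _ ss c0 (src_one G) (conj0_one k)).
by apply: eq_dif_at => h; rewrite !src_mul -uni_inv !(lgu_st _).1.
Qed.

Lemma T_Ad (k : g0 G) (b : Tan e1) :
  T (Ad (o := op1 G) (uni k) b) = Ad (o := op0 G) k (T b).
Proof.
have c0 := smooth_conj k (op0P G); have c1 := smooth_conj (uni k) (op1P G).
have st := @smooth_tgt _ G.
rewrite /Ad (dif_at_comp _ c1 st (conj1_one _) (tgt_one G)).
rewrite (dif_at_comp _ st c0 (tgt_one G) (conj0_one k)).
by apply: eq_dif_at => h; rewrite !tgt_mul -uni_inv !(lgu_st _).2.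
Qed.

(** In the formula [b + (a - U (S b))] every operation commutes with the adjoint action; hence
    composites of equivariant maps are equivariant. *)
Lemma gcomp_Ad (k : g0 G) (a b : Tan e1) : S b = T a ->
  gcomp (D := LG G) (Ad (o := op1 G) (uni k) b) (Ad (o := op1 G) (uni k) a) =
  Ad (o := op1 G) (uni k) (gcomp (D := LG G) b a).
Proof.
move=> ba; rewrite !gcomp_LG // ?S_Ad ?T_Ad ?ba // U_Ad.
by rewrite /Ad !dif_atD dif_atN.
Qed.

Lemma fibre_linear_gcomp (M : smoothSpace R) (b a : TM M -> TanS e1) :
  (forall v, S (b v) = T (a v)) -> fibre_linear b -> fibre_linear a ->
  fibre_linear (fun v => gcomp (D := LG G) (b v) (a v) : TanS e1).
Proof.
move=> ba lb la p c u v; rewrite !gcomp_LG // lb la.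
have -> : U (S (c *: (b (tvec u) : Tan e1) + b (tvec v))) =
    c *: U (S (b (tvec u))) + U (S (b (tvec v))).
  by rewrite dif_at_linear dif_at_linear.
rewrite !scalerDr scalerN opprD [RHS]addrACA; congr (_ + _).
by rewrite addrACA.
Qed.

End Adjoint.

Lemma fibre_linear_dif (R : realType) (M N P : smoothSpace R) (q : P)
    (w : TM N -> TanS q) (f : M -> N) :
  fibre_linear w -> fibre_linear (fun v => w (dif f v)).
Proof.
move=> lw p a u v; rewrite -lw; congr w; congr tvec.
exact: dif_at_linear.
Qed.

(** * The gauge 2-group *)

Section Gauge.
Variables (R : realType) (G : lie2group R) (X : lieGroupoid R).
Variable E : principal2bundle G X.
Let LE := lawful_lie E.
Implicit Types (F : fpair E E) (Psi : nt E E).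

Lemma src_act (p : g1 E) (g : g1 G) : src (act1 E p g) = act0 E (src p) (src g).
Proof. by have [_ H _ _] := act_mor E; case: (H (p, g)). Qed.

Lemma tgt_act (p : g1 E) (g : g1 G) : tgt (act1 E p g) = act0 E (tgt p) (tgt g).
Proof. by have [_ H _ _] := act_mor E; case: (H (p, g)). Qed.

Lemma act_uni (p : g0 E) (g : g0 G) : act1 E (uni p) (uni g) = uni (act0 E p g).
Proof. by have [_ _ H _] := act_mor E; exact: (H (p, g)). Qed.

(** The action is a functor on the product groupoid, and [uni g] composed with itself is [uni g]. *)
Lemma gcomp_act (b a : g1 E) (g : g0 G) : src b = tgt a ->
  gcomp (act1 E b (uni g)) (act1 E a (uni g)) = act1 E (gcomp b a) (uni g).
Proof.
move=> ba; have H := is_comp_gcomp LE ba.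
have K := (lg_unit (uni g : g1 G)).1; rewrite (lgu_st g).1 in K.
exact: (gcompP LE (mor_is_comp (act_mor E) (is_comp_prod H K))).
Qed.

Lemma inv_act (a : g1 E) (g : g0 G) :
  inv (act1 E a (uni g)) = act1 E (inv a) (uni g).
Proof.
have [s t] := lgi_st a; have [us ut] := lgu_st g.
apply: esym; apply: inv_unique; first by rewrite src_act tgt_act s us ut.
by rewrite gcomp_act // gcomp_invl act_uni src_act us.
Qed.

Lemma src_proj (a : g1 E) : src (bproj1 E a) = bproj0 E (src a).
Proof. by have [_ H _ _] := proj_mor E; case: (H a). Qed.

Lemma tgt_proj (a : g1 E) : tgt (bproj1 E a) = bproj0 E (tgt a).
Proof. by have [_ H _ _] := proj_mor E; case: (H a). Qed.

Lemma proj_uni (p : g0 E) : bproj1 E (uni p) = uni (bproj0 E p).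
Proof. by have [_ _ H _] := proj_mor E; exact: (H p). Qed.

Lemma proj_gcomp_uni (b a : g1 E) (x : g0 X) : src b = tgt a ->
  bproj1 E b = uni x -> bproj1 E a = uni x -> bproj1 E (gcomp b a) = uni x.
Proof.
move=> ba pb pa; have := mor_is_comp (proj_mor E) (is_comp_gcomp LE ba).
rewrite /= pb pa => /(gcompP (lawful_lie X)) <-.
by rewrite (gcomp_unir (lawful_lie X)) // (lgu_st x).1.
Qed.

(** Projecting [inv a o a = uni (src a)] to the base leaves [bproj1 E (inv a)] composed with a
    unit. *)
Lemma proj_inv_uni (a : g1 E) (x : g0 X) :
  bproj1 E a = uni x -> bproj1 E (inv a) = uni x.
Proof.
move=> pa; have [s t] := lgi_st a.
have sx : bproj0 E (src a) = x by rewrite -src_proj pa (lgu_st x).1.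
have tx : bproj0 E (tgt a) = x by rewrite -tgt_proj pa (lgu_st x).2.
have := mor_is_comp (proj_mor E) (lg_inv a).1.
rewrite /= pa proj_uni sx => /(gcompP (lawful_lie X)).
by rewrite (gcomp_unir (lawful_lie X)) // src_proj s.
Qed.

Lemma gauge_mor F : gauge_ob F -> is_mor F. Proof. by case. Qed.

Lemma gauge_ob_id : gauge_ob (fid E).
Proof. by split=> //; [exact: mor_id|exists (fid E); split=> //; exact: mor_id]. Qed.

Lemma gauge_ob_comp F F' : gauge_ob F -> gauge_ob F' -> gauge_ob (fcomp F F').
Proof.
move=> [m [H [mH FH HF]] [a1 a0] [p1 p0]] [m' [H' [mH' FH' HF']] [a1' a0'] [p1' p0']].
split; first exact: mor_comp.
- exists (fcomp H' H); split; first exact: mor_comp.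
    (* Composition of functors is associative by conversion; after regrouping, [F'] cancels against
       [H']. *)
    by rewrite -[RHS]FH -[in RHS](_ : fcomp F (fcomp (fcomp F' H') H) = fcomp F H) // FH'.
  by rewrite -[RHS]HF' -[in RHS](_ : fcomp H' (fcomp (fcomp H F) F') = fcomp H' F') // HF.
- by split=> p g /=; rewrite ?a1' ?a1 ?a0' ?a0.
- by split=> p /=; rewrite ?p1 ?p0.
Qed.

(** The inverse in [gauge_ob] is only required to be a functor; equivariance and compatibility with
    the projections follow by writing a point as the image under [F] of its image under [H]. *)
Lemma gauge_ob_inv F : gauge_ob F ->
  exists H, [/\ gauge_ob H, fcomp F H = fid E & fcomp H F = fid E].
Proof.
move=> [m [H [mH FH HF]] [a1 a0] [p1 p0]]; exists H; split=> //.
have fh1 x : F.1 (H.1 x) = x by exact: (congr1 (fun K => K.1 x) FH).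
have fh0 x : F.2 (H.2 x) = x by exact: (congr1 (fun K => K.2 x) FH).
have hf1 x : H.1 (F.1 x) = x by exact: (congr1 (fun K => K.1 x) HF).
have hf0 x : H.2 (F.2 x) = x by exact: (congr1 (fun K => K.2 x) HF).
split=> //; first by exists F.
- by split=> p g; [rewrite -{1}[p]fh1 -a1 hf1|rewrite -{1}[p]fh0 -a0 hf0].
- by split=> p; [rewrite -p1 fh1|rewrite -p0 fh0].
Qed.

Lemma gauge_ar_ntrans Psi : gauge_ar Psi -> ntrans Psi.
Proof. by case=> -[/gauge_mor ? /gauge_mor ?] ? _ _. Qed.

Lemma gauge_ar_nid F : gauge_ob F -> gauge_ar (nid F).
Proof.
move=> gF; case: (gF) => mF _ [_ a0] [_ p0]; split=> //=.
- exact: (nat_id LE).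
- by move=> p g; rewrite a0 act_uni.
- by move=> p; rewrite proj_uni p0.
Qed.

Lemma gauge_ar_vcomp Psi Psi' : gauge_ar Psi -> gauge_ar Psi' ->
  ndom Psi' = ncod Psi -> gauge_ar (vcomp Psi' Psi).
Proof.
move=> gP gP' e; have n := gauge_ar_ntrans gP; have n' := gauge_ar_ntrans gP'.
have [_ _ nv] := ntrans_vcomp LE n n' e.
case: gP gP' => [[gd gc] _ a p] [[gd' gc'] _ a' p'].
have pr x : src (Psi' x) = tgt (Psi x).
  by rewrite (ntrans_src _ n') (ntrans_tgt _ n) e.
split=> //= q.
- by move=> g; rewrite a a' gcomp_act.
- by rewrite (proj_gcomp_uni (x := bproj0 E q)).
Qed.

Lemma gauge_ar_hcomp Psi Psi' : gauge_ar Psi' -> gauge_ar Psi ->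
  gauge_ar (hcomp Psi' Psi).
Proof.
move=> gP' gP; have n := gauge_ar_ntrans gP; have n' := gauge_ar_ntrans gP'.
have [_ _ nv] := ntrans_hcomp LE n' n.
case: gP gP' => [[gd gc] _ a p] [[gd' gc'] _ a' p'].
have pr x : src (Psi' ((ncod Psi).2 x)) = tgt ((ndom Psi').1 (Psi x)).
  case: (gd') => -[_ st _ _] _ _ _.
  by rewrite (st _).2 (ntrans_src _ n') (ntrans_tgt _ n).
case: (gc) (gd') => _ _ [_ ac] [_ pc] [_ _ [ad _] [pd _]].
split=> //=; first by split; exact: gauge_ob_comp.
- by move=> q g; rewrite a ac a' ad gcomp_act.
- move=> q; apply: proj_gcomp_uni => //.
    by rewrite p' pc.
  by rewrite pd p.
Qed.

Lemma gauge_ar_inv Psi : gauge_ar Psi -> exists Phi,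
  [/\ gauge_ar Phi, hcomp Psi Phi = nid (fid E) & hcomp Phi Psi = nid (fid E)].
Proof.
move=> gP; have n := gauge_ar_ntrans gP.
case: (gP) => [[gd gc] [sm st nat] a p].
have [H [gH FH HF]] := gauge_ob_inv gd.
have [H' [gH' FH' HF']] := gauge_ob_inv gc.
set F := ndom Psi in FH HF gd st nat *; set F' := ncod Psi in FH' HF' gc st nat *.
have fh1 x : F.1 (H.1 x) = x by exact: (congr1 (fun K => K.1 x) FH).
have hf1 x : H.1 (F.1 x) = x by exact: (congr1 (fun K => K.1 x) HF).
have hf0 x : H.2 (F.2 x) = x by exact: (congr1 (fun K => K.2 x) HF).
have fh1' x : F'.1 (H'.1 x) = x by exact: (congr1 (fun K => K.1 x) FH').
have fh0' x : F'.2 (H'.2 x) = x by exact: (congr1 (fun K => K.2 x) FH').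
have hf0' x : H'.2 (F'.2 x) = x by exact: (congr1 (fun K => K.2 x) HF').
have mH := gauge_mor gH; have mH' := gauge_mor gH'.
case: (gH) => [[[sH _] Hst Hu _] _ [aH _] [pH _]].
case: (gH') => [[[_ sH'] Hst' _ _] _ [_ aH'] [_ pH']].
(* [H] and [H'] invert the source and the target functor of [Psi]. The arrow [q x] runs from [x] to
   [F (H' x)], so its image under [H] runs from [H x] to [H' x], as required of a transformation
   from [H] to [H']. *)
pose q x := inv (Psi (H'.2 x)).
have sq x : src (q x) = x.
  by rewrite /q (lgi_st _).1 (st _).2 fh0'.
have tq x : tgt (q x) = F.2 (H'.2 x).
  by rewrite /q (lgi_st _).2 (st _).1.
pose Phi := Nt H H' (fun x => H.1 (q x)).
exists Phi; split.
- split=> //=.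
  + apply/(natE LE _ mH mH'); split.
    * exact: (smooth_comp sH (smooth_comp (@smooth_inv _ E) (smooth_comp sm sH'))).
    * by move=> x; rewrite (Hst _).1 (Hst _).2 sq tq hf0.
    * move=> f /=.
      have c1 : src (q (tgt f)) = tgt f by rewrite sq.
      have c2 : src (F.1 (H'.1 f)) = tgt (q (src f)).
        by case: (gauge_mor gd) => _ dst _ _; rewrite (dst _).1 (Hst' _).1 tq.
      rewrite (gcompP LE (mor_is_comp mH (is_comp_gcomp LE c1))).
      (* Writing [H' f] as [H (F (H' f))] puts both sides into the image of [H], so that the square
         can be checked before applying [H]. *)
      rewrite -[H'.1 f]hf1.
      rewrite (gcompP LE (mor_is_comp mH (is_comp_gcomp LE c2))); congr (H.1 _).
      have := ntrans_nat LE (H'.1 f) n; rewrite -/F -/F' fh1'.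
      rewrite (Hst' _).1 (Hst' _).2 => N.
      have i1 := gcomp_invr (Psi (H'.2 (src f))).
      have i2 := gcomp_invl (Psi (H'.2 (tgt f))).
      have c3 : src (Psi (H'.2 (tgt f))) = tgt (F.1 (H'.1 f)).
        by case: (gauge_mor gd) => _ dst _ _; rewrite (st _).1 (dst _).2 (Hst' _).2.
      have c4 : src f = tgt (Psi (H'.2 (src f))) by rewrite (st _).2 fh0'.
      have c5 : src (q (tgt f)) = tgt (Psi (H'.2 (tgt f))) by rewrite (lgi_st _).1.
      have c6 : src (Psi (H'.2 (src f))) = tgt (q (src f)) by rewrite (lgi_st _).2.
      have c7 : src (Psi (H'.2 (tgt f))) = tgt (gcomp (F.1 (H'.1 f)) (q (src f))).
        by rewrite (tgt_gcomp LE).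
      (* Naturality of [Psi] at [H' f], solved for [f]. *)
      have fE : f = gcomp (Psi (H'.2 (tgt f))) (gcomp (F.1 (H'.1 f)) (q (src f))).
        by rewrite (gcompA LE) // N -(gcompA LE) // i1 (gcomp_unir LE).
      rewrite [X in gcomp _ X = _]fE (gcompA LE) // i2 (gcomp_unil LE) //.
  + move=> x g; rewrite -aH; congr (H.1 _).
    by rewrite /q aH' a inv_act.
  + by move=> x; rewrite pH; apply: proj_inv_uni; rewrite p pH'.
- apply: nt_ext => //= x; rewrite -/F fh1 gcomp_invr (st _).2.
  by rewrite fh0'.
- apply: nt_ext => //= x; rewrite -/F' /q hf0'.
  have c : src (inv (Psi x)) = tgt (Psi x) by rewrite (lgi_st _).1.
  rewrite (gcompP LE (mor_is_comp mH (is_comp_gcomp LE c))) gcomp_invl.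
  by rewrite (st _).1 Hu hf0.
Qed.

Lemma gauge_cat_is_category : is_category (gauge_cat E).
Proof.
split=> /=.
- by move=> f [].
- by move=> F gF; split=> //; exact: gauge_ar_nid.
- by move=> f g gf gg e; split=> //; exact: gauge_ar_vcomp.
- move=> f /gauge_ar_ntrans n.
  by rewrite (vcomp_nidr LE n) (vcomp_nidl LE n).
- move=> f g h /gauge_ar_ntrans nf /gauge_ar_ntrans ng /gauge_ar_ntrans nh e e'.
  exact: (vcompA LE).
Qed.

Lemma gauge_grp0 : is_group (@cob (gauge_2group E)) (grp0 (gauge_2group E)).
Proof.
apply: is_group_of => /=.
- exact: gauge_ob_id.
- exact: gauge_ob_comp.
- by [].
- by case.
- exact: gauge_ob_inv.
Qed.

Lemma hcomp_is_comp Psi Psi' x : ntrans Psi' -> ntrans Psi ->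
  is_comp (Psi' ((ncod Psi).2 x)) ((ndom Psi').1 (Psi x)) (hcomp Psi' Psi x).
Proof.
move=> n' n; apply: (is_comp_gcomp LE).
by case: (n') => -[_ st _ _] _ _; rewrite (st _).2 ntrans_src // ntrans_tgt.
Qed.

Lemma vcomp_is_comp Psi Psi' x : ntrans Psi' -> ntrans Psi ->
  ndom Psi' = ncod Psi -> is_comp (Psi' x) (Psi x) (vcomp Psi' Psi x).
Proof.
move=> n' n e; apply: (is_comp_gcomp LE).
by rewrite ntrans_src // ntrans_tgt // e.
Qed.

Lemma gauge_grp1 : is_group (@car (gauge_2group E)) (grp1 (gauge_2group E)).
Proof.
apply: is_group_of => /=.
- exact: (gauge_ar_nid gauge_ob_id).
- by move=> x y; exact: gauge_ar_hcomp.
- move=> x y z /gauge_ar_ntrans nx /gauge_ar_ntrans ny /gauge_ar_ntrans nz.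
  by apply: (hcompA LE) => // t; exact: hcomp_is_comp.
- move=> Psi /gauge_ar_ntrans n; case: (n) => mF mF' _; split.
    apply: nt_ext => [||x] /=; [by case: (ndom Psi)|by case: (ncod Psi)|].
    by rewrite (gcomp_unil LE) // ntrans_tgt.
  apply: nt_ext => [||x] /=; [by case: (ndom Psi)|by case: (ncod Psi)|].
  case: mF => _ _ Fu _; rewrite Fu (gcomp_unir LE) // ntrans_src //.
- exact: gauge_ar_inv.
Qed.

Lemma gauge_interchange (f g f' g' : nt E E) : gauge_ar f -> gauge_ar g ->
  gauge_ar f' -> gauge_ar g' -> ndom g = ncod f -> ndom g' = ncod f' ->
  hcomp (vcomp g f) (vcomp g' f') = vcomp (hcomp g g') (hcomp f f').
Proof.
move=> /gauge_ar_ntrans nf /gauge_ar_ntrans ng /gauge_ar_ntrans nf'.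
move=> /gauge_ar_ntrans ng' e e'.
by apply: (hcomp_vcomp LE) => // x; exact: vcomp_is_comp.
Qed.

Lemma gauge_2group_strict : is_strict_2group (gauge_2group E).
Proof.
split; [exact: gauge_cat_is_category|exact: gauge_grp0|exact: gauge_grp1|by []|].
split=> /= [x y gx gy|]; last exact: gauge_interchange.
by rewrite (hcomp_nid LE) //; exact: gauge_mor.
Qed.

Local Notation inv0 := (ginv (grp0 (gauge_2group E))).
Local Notation inv1 := (ginv (grp1 (gauge_2group E))).

(** Source and target send horizontal composition to composition of functors, so the ends of
    [inv1 Psi] are right inverses of the ends of [Psi]. *)
Lemma ginv_ends Psi : gauge_ar Psi ->
  ndom (inv1 Psi) = inv0 (ndom Psi) /\ ncod (inv1 Psi) = inv0 (ncod Psi).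
Proof.
move=> gP; have gV := ginv_closed gauge_grp1 gP.
have [_ _ _ _ /(_ _ gP)[_ _ e]] := gauge_grp1.
case: (gP) (gV) => [[gd gc] _ _ _] [[gd' gc'] _ _ _].
by split; apply: esym; apply: (ginv_uniq gauge_grp0) => //;
  [have := congr1 (@ndom _ _ _) e|have := congr1 (@ncod _ _ _) e].
Qed.

Lemma ginv_nid F : gauge_ob F -> inv1 (nid F) = nid (inv0 F).
Proof.
move=> gF; have gV := ginv_closed gauge_grp0 gF.
have [_ _ _ _ /(_ _ gF)[_ _ e]] := gauge_grp0.
apply: (ginv_uniq gauge_grp1); [exact: gauge_ar_nid|exact: gauge_ar_nid|].
by rewrite /= (hcomp_nid LE) ?[fcomp F _]e //; exact: gauge_mor.
Qed.

(** By interchange, the product of the two vertical composites is a vertical composite of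
    identities; uniqueness of inverses concludes. *)
Lemma ginv_vcomp Psi Psi' : gauge_ar Psi -> gauge_ar Psi' ->
  ndom Psi' = ncod Psi -> inv1 (vcomp Psi' Psi) = vcomp (inv1 Psi') (inv1 Psi).
Proof.
move=> gP gP' e; have gV := ginv_closed gauge_grp1 gP.
have gV' := ginv_closed gauge_grp1 gP'.
have e' : ndom (inv1 Psi') = ncod (inv1 Psi).
  by rewrite (ginv_ends gP').1 (ginv_ends gP).2 e.
apply: (ginv_uniq gauge_grp1); [exact: gauge_ar_vcomp|exact: gauge_ar_vcomp|].
have [_ _ _ _ V] := gauge_grp1; have [_ _ i] := V _ gP; have [_ _ i'] := V _ gP'.
rewrite [LHS]gauge_interchange // [hcomp Psi' _]i' [hcomp Psi _]i.
exact: (vcomp_nidr LE (ntrans_nid LE (mor_id E))).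
Qed.

End Gauge.

(** * Connection 1-forms *)

Section Connections.
Variables (R : realType) (G : lie2group R) (X : lieGroupoid R).
Variable E : principal2bundle G X.
Let LL := lawful_LG G.
Notation e0 := (gone (op0 G)).
Notation e1 := (gone (op1 G)).
Implicit Types (F : fpair E E) (w : fpair (TG E) (LG G)) (eta : nt (TG E) (LG G)).

Lemma smooth_orbit (P M : smoothSpace R) (o : groupOps M) (act : P -> M -> P) p :
  is_right_action o act -> smooth (fun g => act p g).
Proof.
by case=> sa _ _; exact: (smooth_comp sa (smooth_pair (@smooth_cst _ M P p) (@smooth_id _ M))).
Qed.

Lemma smooth_ract (P M : smoothSpace R) (o : groupOps M) (act : P -> M -> P) g :
  is_right_action o act -> smooth (fun p => act p g).
Proof.
by case=> sa _ _; exact: (smooth_comp sa (smooth_pair (@smooth_id _ P) (@smooth_cst _ P M g))).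
Qed.

(** Equivariance of [f], differentiated in the group variable at the unit: fundamental vectors are
    preserved. *)
Lemma dif_orbit (P M : smoothSpace R) (o : groupOps M) (act : P -> M -> P)
    (f : P -> P) p (B : Tan (gone o)) : is_right_action o act -> smooth f ->
  (forall p g, f (act p g) = act (f p) g) ->
  dif f (tvec (dif_at (fun g => act p g) (gone o) p B)) =
  tvec (dif_at (fun g => act (f p) g) (gone o) (f p) B).
Proof.
move=> ra sf fa; have so := smooth_orbit p ra; case: ra => _ a1 _.
rewrite /dif /=; congr tvec; rewrite (dif_at_comp _ so sf (a1 p) erefl).
by apply: eq_dif_at => g; rewrite fa.
Qed.

(** Two actions and two group elements appear because a gauge arrow carries the action of [g] on
    objects to the action of [uni g] on arrows. *)
Lemma dif_ract (P M P' M' : smoothSpace R) (o : groupOps M) (o' : groupOps M')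
    (act : P -> M -> P) (act' : P' -> M' -> P')
    (f : P -> P') g g' (v : TM P) : is_right_action o act ->
  is_right_action o' act' -> smooth f ->
  (forall p, f (act p g) = act' (f p) g') ->
  dif f (dif (fun p => act p g) v) = dif (fun p => act' p g') (dif f v).
Proof.
move=> ra ra' sf fa; have so := smooth_ract g ra; have so' := smooth_ract g' ra'.
by rewrite !dif_comp //; congr dif; apply: funext.
Qed.

Definition prod_fid (F : fpair E E) : fpair (prodG E (LG G)) (prodG E (LG G)) :=
  (fun x => (F.1 x.1, x.2), fun x => (F.2 x.1, x.2)).

Lemma gauge_delta F : gauge_ob F ->
  fcomp (Tfun F) (delta E) =
  fcomp (delta E) (prod_fid F).
Proof.
case=> -[[s1 s0] _ _ _] _ [a1 a0] _; congr pair; apply: funext => x /=.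
- by rewrite (dif_orbit _ _ (act1P E)).
- by rewrite (dif_orbit _ _ (act0P E)).
Qed.

(** By [gauge_delta], [Tfun F] can be traded for [prod_fid F], which leaves the projection to L(G)
    unchanged. *)
Lemma strict_gauge F w : gauge_ob F -> strict w -> strict (fcomp w (Tfun F)).
Proof.
move=> gF sw; rewrite /strict -[LHS]/(fcomp w (fcomp (Tfun F) (delta E))) gauge_delta //.
by rewrite -[LHS]/(fcomp (fcomp w (delta E)) _) sw.
Qed.

Lemma semi_strict_mor w : semi_strict w -> is_mor w. Proof. by case. Qed.

Lemma semi_strict_gauge F w : gauge_ob F -> semi_strict w ->
  semi_strict (fcomp w (Tfun F)).
Proof.
move=> gF [mw [[sw1 lw1] [sw0 lw0]] [a1 a0] [kappa [nk lk ak]]].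
have mF := gauge_mor gF; case: (gF) => [[[s1 s0] Fst _ _] _ [aF1 aF0] _].
split.
- by apply: mor_comp => //; exact: mor_Tfun.
- split; split; [|exact: fibre_linear_dif| |exact: fibre_linear_dif].
    exact: (smooth_comp sw1 (smooth_dif s1)).
  exact: (smooth_comp sw0 (smooth_dif s0)).
- split=> v g /=.
    by rewrite -a1 /tact1 (dif_ract _ (act1P E) (act1P E) s1 (fun p => aF1 p g)).
  by rewrite -a0 /tact0 (dif_ract _ (act0P E) (act0P E) s0 (fun p => aF0 p g)).
(* The transported [kappa] is the old one composed with [prod_fid F]; [gauge_delta] identifies its
   source functor. *)
- exists (fun x => kappa (F.2 x.1, x.2)); split.
  + case: nk => sk stk natk; split.
    * apply: (smooth_comp sk); apply: smooth_pair.
        exact: (smooth_comp s0 (@smooth_fst _ _ _)).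
      exact: smooth_snd.
    * move=> x; have [-> ->] := stk (F.2 x.1, x.2); split=> //.
      exact: (esym (congr1 (fun K => w.2 (K.2 x)) (gauge_delta gF))).
    (* Naturality at [f] is that of [kappa] at the image of [f] under [prod_fid F]. *)
    * move=> f; have [h [h1 h2]] := natk ((prod_fid F).1 f).
      have es : src ((prod_fid F).1 f) = (prod_fid F).2 (src f).
        exact: (congr1 (fun k => (k, _)) (Fst f.1).1).
      have et : tgt ((prod_fid F).1 f) = (prod_fid F).2 (tgt f).
        exact: (congr1 (fun k => (k, _)) (Fst f.1).2).
      have ed := congr1 (fun K => w.1 (K.1 f)) (gauge_delta gF).
      rewrite et -[(_).1 _]ed in h1; rewrite es in h2.
      by exists h.
  + by move=> p; exact: (lk (F.2 p)).
  + by move=> p B g; rewrite /= aF0 ak.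
Qed.

Lemma omega_ar_ntrans eta : omega_ar eta -> ntrans eta.
Proof. by case=> -[/semi_strict_mor ? /semi_strict_mor ?] ? _ _. Qed.

Lemma omega_ar_nid w : semi_strict w -> omega_ar (nid w).
Proof.
move=> sw; case: (sw) => mw [_ [sw0 lw0]] [_ a0] _.
have n := nat_id LL mw; split=> //.
- split; first by case: n.
  by move=> p a u v /=; rewrite lw0 dif_at_linear.
- by move=> v g /=; rewrite a0 -uni_inv -U_Ad.
Qed.

Lemma omega_ar_vcomp eta eta' : omega_ar eta -> omega_ar eta' ->
  ndom eta' = ncod eta -> omega_ar (vcomp eta' eta).
Proof.
move=> o o' e; have n := omega_ar_ntrans o; have n' := omega_ar_ntrans o'.
have [_ _ nv] := ntrans_vcomp LL n n' e.
case: o o' => [[sd sc] _ [_ l] a] [[sd' sc'] _ [_ l'] a'].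
have pr v : src (g := LG G) (eta' v) = tgt (g := LG G) (eta v).
  by rewrite (ntrans_src _ n') (ntrans_tgt _ n) e.
split=> //.
- split; first by case: nv.
  exact: (fibre_linear_gcomp pr l' l).
- by move=> v g /=; rewrite a a' -uni_inv (gcomp_Ad _ (pr v)).
Qed.

(** At [v] the value composes [eta] at the image of [v] under the target functor with the arrow form
    [(ndom eta).1] at [Tnt Psi v]. Both factors are fibrewise linear and equivariant in [v]; for the
    second, [Tnt Psi] carries translation by [g] to translation by [uni g]. *)
Lemma omega_ar_hcomp eta (Psi : nt E E) : omega_ar eta -> gauge_ar Psi ->
  omega_ar (hcomp eta (Tnt Psi)).
Proof.
move=> o gP; have n := omega_ar_ntrans o.
have nP := ntrans_Tnt (gauge_ar_ntrans gP).
have [_ _ nv] := ntrans_hcomp LL n nP.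
case: o => [[sd sc] _ [_ l] a]; case: gP => [[gd gc] [sP _ _] aP _].
have pr v : src (g := LG G) (eta ((ncod (Tnt Psi)).2 v)) =
            tgt (g := LG G) ((ndom eta).1 (Tnt Psi v)).
  case: (sd) => -[_ st _ _] _ _ _.
  by rewrite (st _).2 (ntrans_src _ n) (ntrans_tgt _ nP).
split=> //.
- by split; apply: semi_strict_gauge.
- split; first by case: nv.
  apply: (fibre_linear_gcomp pr); first exact: fibre_linear_dif.
  by case: sd => _ [[_ l1] _] _ _; exact: fibre_linear_dif.
- move=> v g; rewrite -uni_inv -[RHS](gcomp_Ad _ (pr v)) uni_inv.
  case: (gc) => -[[_ sc0] _ _ _] _ [_ ac] _.
  case: (sd) => _ _ [a1 _] _.
  rewrite -a -a1 /tact0 /tact1 [LHS]/= [RHS]/=.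
  rewrite (dif_ract _ (act0P E) (act0P E) sc0 (fun p => ac p g)).
  by rewrite (dif_ract _ (act0P E) (act1P E) sP (fun p => aP p g)).
Qed.

Lemma Omega_semi_category : is_category (Omega_semi E).
Proof.
split=> /=.
- by move=> f [].
- by move=> w sw; split=> //; exact: omega_ar_nid.
- by move=> f g of_ og e; split=> //; exact: omega_ar_vcomp.
- move=> f /omega_ar_ntrans n.
  by rewrite (vcomp_nidr LL n) (vcomp_nidl LL n).
- move=> f g h /omega_ar_ntrans nf /omega_ar_ntrans ng /omega_ar_ntrans nh e e'.
  exact: (vcompA LL).
Qed.

(** * The action of the gauge 2-group *)

Local Notation K := (gauge_2group E).

Lemma gauge_action_semi : is_action (K := K) (D := Omega_semi E)
  (@gauge_act0 R G X E) (@gauge_act1 R G X E).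
Proof.
have V0 F : gauge_ob F -> gauge_ob (ginv (grp0 K) F) by exact: (ginv_closed (gauge_grp0 E)).
have V1 Psi : gauge_ar Psi -> gauge_ar (ginv (grp1 K) Psi) by exact: (ginv_closed (gauge_grp1 E)).
rewrite /gauge_act0 /gauge_act1; split.
- split=> [F w gF sw|f g gf og]; first exact: semi_strict_gauge (V0 _ gF) sw.
  have [d c] := ginv_ends gf; split; first exact: omega_ar_hcomp (V1 _ gf).
    by rewrite -d.
  by rewrite -c.
- move=> F w gF sw; rewrite [ginv _ _]ginv_nid // Tnt_nid; last exact: gauge_mor (V0 _ gF).
  by rewrite (hcomp_nid LL) //; exact: semi_strict_mor.
(* Once inversion is moved inside the vertical composite, the claim is the interchange law. *)
- move=> f f' g g' gf gf' og og' ef eg; rewrite [ginv _ _]ginv_vcomp //.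
  have nf := gauge_ar_ntrans (V1 _ gf); have nf' := gauge_ar_ntrans (V1 _ gf').
  have e : ndom (ginv (grp1 K) f') = ncod (ginv (grp1 K) f).
    by rewrite (ginv_ends gf').1 (ginv_ends gf).2 -[ncod f]ef.
  apply: (hcomp_vcomp LL) => //.
  + exact: omega_ar_ntrans.
  + exact: omega_ar_ntrans.
  + exact: ntrans_Tnt.
  + exact: ntrans_Tnt.
  + by rewrite [LHS](congr1 (@Tfun R E E) e).
  + move=> v; apply: is_comp_TG => [||x]; last exact: vcomp_is_comp.
    * by case: nf => _ _ [].
    * by case: nf' => _ _ [].
- split=> [w _|F F' w gF gF' sw].
    by rewrite (ginv_one (gauge_grp0 E)) [Tfun _]Tfun_id; case: w.
  (* Inversion reverses products and so does precomposition; together they give a left action. *)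
  rewrite (ginv_mul (gauge_grp0 E)) // [Tfun _]Tfun_comp //.
    exact: gauge_mor (V0 _ gF').
  exact: gauge_mor (V0 _ gF).
- split=> [g og|f f' g gf gf' og].
    have n := omega_ar_ntrans og; have [mg _ _] := n.
    rewrite (ginv_one (gauge_grp1 E)) [Tnt _]Tnt_nid ?Tfun_id; last exact: mor_id.
    apply: nt_ext => [||v]; [by rewrite /=; case: (ndom g)|by rewrite /=; case: (ncod g)|].
    case: mg => _ _ mu _; transitivity (gcomp (g v) ((ndom g).1 (uni v))) => //.
    by rewrite mu (gcomp_unir LL) // ntrans_src.
  have nf := gauge_ar_ntrans (V1 _ gf); have nf' := gauge_ar_ntrans (V1 _ gf').
  rewrite (ginv_mul (gauge_grp1 E)) //.
  have [md mc [sf _ _]] := nf; have [md' mc' [sf' _ _]] := nf'.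
  (* Here [kappa] is the differential of the horizontal product of the two inverses in [E]. *)
  apply: (hcompA LL).
  + exact: omega_ar_ntrans.
  + exact: ntrans_Tnt.
  + exact: ntrans_Tnt.
  + by rewrite -[RHS]Tfun_comp.
  + by rewrite -[RHS]Tfun_comp.
  + have [[s1 _] _ _ _] := md'; have [[_ s2] _ _ _] := mc.
    (* [is_comp_TG] takes differentials of maps defined on [g0 E], so iterated differentials are
       merged first. *)
    move=> v; rewrite [X in is_comp X _ _]dif_comp // [X in is_comp _ X _]dif_comp //.
    apply: is_comp_TG => [||x].
    * exact: (smooth_comp s1 sf).
    * exact: (smooth_comp sf' s2).
    * exact: hcomp_is_comp.
Qed.

(** The strict forms span a full subcategory, so all equations are inherited; what remains is
    strictness of the images, given by [strict_gauge] at the inverse transformation. *)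
Lemma gauge_action_strict : is_action (K := K) (D := Omega_strict E)
  (@gauge_act0 R G X E) (@gauge_act1 R G X E).
Proof.
have V0 F : gauge_ob F -> gauge_ob (ginv (grp0 K) F) by exact: (ginv_closed (gauge_grp0 E)).
have [[A1 A2] B C [D1 D2] [E1 E2]] := gauge_action_semi.
split; first split.
- move=> F w gF [sw w1]; split; first exact: A1.
  exact: strict_gauge (V0 _ gF) w1.
- move=> f g gf [og s t]; have [c1 c2 c3] := A2 f g gf og; split=> //.
  have [gd gc] : gauge_ob (ndom f) /\ gauge_ob (ncod f) by case: gf.
  split=> //.
    by rewrite [csrc _]c2; exact: strict_gauge (V0 _ gd) s.
  by rewrite [ctgt _]c3; exact: strict_gauge (V0 _ gc) t.
- by move=> F w gF [sw _]; exact: B.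
- by move=> f f' g g' gf gf' [og _ _] [og' _ _]; exact: C.
- split; first by move=> w [sw _]; exact: D1.
  by move=> F F' w gF gF' [sw _]; exact: D2.
- split; first by move=> g [og _ _]; exact: E1.
  by move=> f f' g gf gf' [og _ _]; exact: E2.
Qed.

End Connections.

(** [is_action] takes raw structures, so the laws of the gauge 2-group and of the category of
    semi-strict forms are asserted alongside. *)
Theorem proposition6p7 (R : realType) (G : lie2group R) (X : lieGroupoid R)
    (E : principal2bundle G X) :
  [/\ is_strict_2group (gauge_2group E),
      is_category (Omega_semi E),
      is_action (K := gauge_2group E) (D := Omega_semi E)
        (@gauge_act0 R G X E) (@gauge_act1 R G X E)
    & is_action (K := gauge_2group E) (D := Omega_strict E)
        (@gauge_act0 R G X E) (@gauge_act1 R G X E)].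
Proof.
split.
- exact: gauge_2group_strict.
- exact: Omega_semi_category.
- exact: gauge_action_semi.
- exact: gauge_action_strict.
Qed.
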